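(* There exist universal constants $A,B,\bar A,\bar B<\infty$ such that the following holds. Let $N\geqslant 1$, let $X_1,\dots,X_N$ be independent random variables with values in a measurable space $(\mathcal X,\mathcal B)$, let $\mathcal F$ be a (non-empty) family of real measurable functions on $(\mathcal X,\mathcal B)$, and let $d$ be a distance on $\mathcal F\cup\{0\}$ such that for all $f,g\in\mathcal F$, all $1\leqslant i\leqslant N$ and all $u>0$ $$\mathbf P(|(f-g)(X_i)|\geqslant u)\leqslant 2\exp\Big(-\frac{u^2}{d(f,g)^2}\Big),\qquad \mathbf P(|f(X_i)|\geqslant u)\leqslant 2\exp\Big(-\frac{u^2}{d(f,0)^2}\Big).$$ Assume that the process $\big((f(X_1),\dots,f(X_N))\big)_{f\in\mathcal F}$ is separable with respect to $d$. Suppose that $\alpha=\sup_{f\in\mathcal F}d(f,0)<\infty$. Then there is a random variable $Z\geqslant 0$ with $\mathbf E Z\leqslant 1$ such that, almost surely, $$\sup_{f\in\mathcal F}\frac1N\sum_{i=1}^N\big(f^2(X_i)-\mathbf E f^2(X_i)\big)\leqslant A\big(N^{-1}\gamma_2^2(\mathcal F)+N^{-1/2}\alpha\,\gamma_2(\mathcal F)\big)+BN^{-1/2}\alpha^2\varphi^{-1}(Z).$$ In terms of concentration, for all $u\geqslant 0$, $$\mathbf P\Big(\sup_{f\in\mathcal F}\frac1N\sum_{i=1}^N\big(f^2(X_i)-\mathbf E f^2(X_i)\big)>\bar A\big(N^{-1}\gamma_2^2(\mathcal F)+N^{-1/2}\alpha\,\gamma_2(\mathcal F)\big)+\bar BN^{-1/2}\alpha^2u\Big)\leqslant\exp\big(-\min\{\sqrt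 N\,u,u^2\}\big).$$
   Context: The function $\varphi=\varphi_{(N)}:[0,\infty)\to[0,\infty)$ is $\varphi(x)=2^{\min\{\sqrt N x,\,x^2\}}-1$, so that $\varphi^{-1}(x)=\max\{N^{-1/2}\log_2(1+x),\sqrt{\log_2(1+x)}\}$. An admissible sequence of nets is a sequence $(\mathcal F_n)_{n\geqslant0}$ of finite non-empty subsets of $\mathcal F$ with $\mathcal F_n\subset\mathcal F_{n+1}$, $|\mathcal F_0|=1$, $|\mathcal F_n|\leqslant N_n=2^{2^{2n}}-1$ for $n\geqslant1$, and $\bigcup_n\mathcal F_n$ dense in $(\mathcal F,d)$. Then $$\gamma_2(\mathcal F)=\inf\ \sup_{f\in\mathcal F}\sum_{n=0}^\infty 2^n d(f,\mathcal F_n),$$ where $d(f,\mathcal F_n)=\min_{g\in\mathcal F_n}d(f,g)$ and the infimum is over all admissible sequences of nets (with $\inf\emptyset=\infty$; if $\gamma_2(\mathcal F)=\infty$ the assertions are trivial). Up to universal constants this is Talagrand's $\gamma_2$ functional of $(\mathcal F,d)$. Convention: $u^2/0=\infty$ and $e^{-\infty}=0$. Separability of the process with respect to $d$: there are a countable set $\mathcal F'\subset\mathcal F$ and a null event outside of which for every $f\in\mathcal F$ there is a sequence $f_k\in\mathcal F'$ with $d(f_k,f)\to0$ and $f_k(X_i)\to f(X_i)$ for all $1\leqslant i\leqslant N$. *)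

(* Defs.v *)
From HB Require Import structures.
From mathcomp Require Import all_boot all_order all_algebra.
From mathcomp Require Import all_classical all_reals all_analysis.
From mathcomp Require Import measurable_realfun.

Set Implicit Arguments.
Unset Strict Implicit.
Unset Printing Implicit Defensive.

Import Order.TTheory GRing.Theory Num.Theory.
Import numFieldNormedType.Exports.

Local Open Scope classical_set_scope.
Local Open Scope ring_scope.

Definition log2 {R : realType} (x : R) : R := ln x / ln 2.

Definition phi {R : realType} (N : nat) (x : R) : R :=
  2 `^ Num.min (Num.sqrt N%:R * x) (x ^+ 2) - 1.

Definition phi_inv {R : realType} (N : nat) (x : R) : R :=
  Num.max ((Num.sqrt N%:R)^-1 * log2 (1 + x)) (Num.sqrt (log2 (1 + x))).

Section phi_inverse.
Context {R : realType} (N : nat).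
Hypothesis N_gt0 : (0 < N)%N.

Let s_gt0 : 0 < Num.sqrt N%:R :> R.
Proof. by rewrite sqrtr_gt0 ltr0n. Qed.

Let ln2_gt0 : 0 < ln 2 :> R.
Proof. by rewrite ln_gt0// ltr1n. Qed.

Let log2_ge0 (x : R) : 0 <= x -> 0 <= log2 (1 + x).
Proof. by move=> x0; rewrite divr_ge0 ?ln_ge0 ?lerDl// ltW. Qed.

Lemma phi_ge0 (x : R) : 0 <= x -> 0 <= phi N x.
Proof.
move=> x0; rewrite subr_ge0 -[leLHS](powRr0 (2 : R)) ler_powR ?ler1n//.
by rewrite le_min mulr_ge0 ?sqr_ge0// ltW.
Qed.

Lemma phi_inv_ge0 (x : R) : 0 <= phi_inv N x.
Proof. by rewrite le_max sqrtr_ge0 orbT. Qed.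

Lemma phiK : {in Num.nneg, cancel (@phi R N) (phi_inv N)}.
Proof.
move=> x; rewrite nnegrE => x0; rewrite /phi_inv /phi addrC subrK /log2 ln_powR.
rewrite mulfK ?gt_eqF//; have [h|h] := leP (Num.sqrt N%:R * x) (x ^+ 2).
- rewrite mulKf ?gt_eqF//; apply/max_idPl.
  by rewrite -[leRHS]ger0_norm// -sqrtr_sqr ler_wsqrtr.
- rewrite sqrtr_sqr ger0_norm//; apply/max_idPr.
  by rewrite ler_pdivrMl// ltW.
Qed.

Lemma phi_invK : {in Num.nneg, cancel (@phi_inv R N) (phi N)}.
Proof.
move=> x; rewrite nnegrE => x0; have y0 := log2_ge0 x0.
rewrite /phi (_ : Num.min _ _ = log2 (1 + x)); last first.
  rewrite /phi_inv; have [h|h] := leP (_^-1 * _) (Num.sqrt _).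
  - rewrite sqr_sqrtr//; apply/min_idPr.
    by rewrite -ler_pdivrMl.
  - rewrite mulVKf ?gt_eqF//; apply/min_idPl.
    rewrite -[leLHS]sqr_sqrtr// ler_sqr ?nnegrE ?sqrtr_ge0//; first exact: ltW.
    by rewrite mulr_ge0// invr_ge0 ltW.
have x1 : 0 < 1 + x by rewrite ltr_wpDr.
by rewrite /powR pnatr_eq0/= /log2 divfK ?gt_eqF// lnK ?posrE// addrC addKr.
Qed.

End phi_inverse.

(* Mutual independence of the sigma-algebras generated by the X i: the product
   rule over every subfamily. *)
Definition mutually_independent {R : realType} {dO dX : measure_display}
    {Omega : measurableType dO} {TX : measurableType dX}
    (P : probability Omega R) (N : nat) (X : 'I_N -> {RV P >-> TX}) :=
  forall (J : {set 'I_N}) (E : 'I_N -> set TX),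
    (forall i, measurable (E i)) ->
    P (\bigcap_(i in [set` J]) (X i @^-1` E i)) =
    (\prod_(i in J) P (X i @^-1` E i))%E.

Arguments mutually_independent {R dO dX Omega TX} P {N} X.

Record is_distance {R : realType} {U : Type} (D : set U) (d : U -> U -> R) :=
  IsDistance {
    distance_ge0 : forall x y, D x -> D y -> 0 <= d x y;
    distance_eq0 : forall x y, D x -> D y -> (d x y = 0 <-> x = y);
    distance_sym : forall x y, D x -> D y -> d x y = d y x;
    distance_triangle : forall x y z, D x -> D y -> D z ->
      d x z <= d x y + d y z
  }.

(* exp (- u^2 / s^2) with the conventions u^2 / 0 = oo and exp (- oo) = 0;
   the test is needed because u^2 / 0 = 0 in the library. *)
Definition gauss_tail {R : realType} (u s : R) : R :=
  if s == 0 then 0 else expR (- (u ^+ 2 / s ^+ 2)).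

(* An event outside of a null event is an {ae P, _} statement: the exceptional
   set is only required to be included in a measurable set of probability 0. *)
Definition separable_process {R : realType} {dO dX : measure_display}
    {Omega : measurableType dO} {TX : measurableType dX}
    (P : probability Omega R) (N : nat) (X : 'I_N -> {RV P >-> TX})
    (F : set (TX -> R)) (d : (TX -> R) -> (TX -> R) -> R) :=
  exists F' : set (TX -> R), [/\ countable F', F' `<=` F &
    {ae P, forall w, forall f, F f ->
      exists fk : nat -> TX -> R, [/\ forall k, F' (fk k),
        d (fk k) f @[k --> \oo] --> (0 : R) &
        forall i, fk k (X i w) @[k --> \oo] --> f (X i w)]}].

Arguments separable_process {R dO dX Omega TX} P {N} X F d.

Record admissible_nets {R : realType} {U : Type} (F : set U)
    (d : U -> U -> R) (Fn : nat -> set U) := AdmissibleNets {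
  nets_finite : forall n, finite_set (Fn n);
  nets_nonempty : forall n, Fn n !=set0;
  nets_sub : forall n, Fn n `<=` F;
  nets_nondecreasing : forall n, Fn n `<=` Fn n.+1;
  nets_card0 : (Fn 0%N #= `I_1)%card;
  nets_card : forall n, (1 <= n)%N ->
    (Fn n #<= `I_((2 ^ (2 ^ (2 * n))).-1)%N)%card;
  nets_dense : forall f, F f -> forall e : R, 0 < e ->
    exists n g, Fn n g /\ d f g < e
}.

(* For finite nonempty G this infimum is the minimum. *)
Definition dist_set {R : realType} {U : Type} (d : U -> U -> R)
    (f : U) (G : set U) : R :=
  inf [set d f g | g in G].

Definition gamma2 {R : realType} {U : Type} (F : set U)
    (d : U -> U -> R) : \bar R :=
  ereal_inf [set ereal_sup
      [set (\sum_(0 <= n <oo) (2 ^+ n * dist_set d f (Fn n))%:E)%E | f in F]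
    | Fn in admissible_nets F d].

Definition sup_centered_squares {R : realType} {dO dX : measure_display}
    {Omega : measurableType dO} {TX : measurableType dX}
    (P : probability Omega R) (N : nat) (X : 'I_N -> {RV P >-> TX})
    (F : set (TX -> R)) (w : Omega) : \bar R :=
  ereal_sup [set ((N%:R^-1)%:E *
      \sum_(i < N) ((f (X i w) ^+ 2)%:E - 'E_P[fun v => (f (X i v) ^+ 2)%R]))%E
    | f in F].

Arguments sup_centered_squares {R dO dX Omega TX} P {N} X F w.

(* g stands for gamma2 F d, which may be infinite. *)
Definition chaining_term {R : realType} (N : nat) (alpha : R) (g : \bar R) :
    \bar R :=
  ((N%:R^-1)%:E * g ^+ 2 + ((Num.sqrt N%:R)^-1 * alpha)%:E * g)%E.

(* Events defined by an uncountable supremum need not be measurable, only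
   measurable up to a null set: the bound is on the completed probability,
   that is on the value of the outer measure of P at a set of the completed
   sigma-algebra. *)
Definition completed_prob_le {R : realType} {dO : measure_display}
    {Omega : measurableType dO} (P : probability Omega R) (E : set Omega)
    (p : R) :=
  completed_algebra_gen P E /\ (P^*%mu E <= p%:E)%E.

(* Main.v *)
Require Import Defs.
From HB Require Import structures.
From mathcomp Require Import all_boot all_order all_algebra.
From mathcomp Require Import all_classical all_reals all_analysis.
From mathcomp Require Import measurable_realfun.
From mathcomp Require Import finmap ring lra.

Set Implicit Arguments.
Unset Strict Implicit.
Unset Printing Implicit Defensive.

Import Order.TTheory GRing.Theory Num.Theory.
Import numFieldNormedType.Exports.

Local Open Scope classical_set_scope.
Local Open Scope ring_scope.

(** Put U(f,g) for the centred sum of f^2(X_i) - g^2(X_i). Since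
    f^2 - g^2 = (f - g)(f + g) has an exponential moment at scale alpha d(f,g),
    Bernstein's inequality controls U(f,g), and sum_i (f - g)^2(X_i) / d(f,g)^2
    has an exponential moment of order C^N. Summing these exponentials over all
    pairs of all nets, with weights of order 2^(-n) / N_n^2, gives one variable
    Z with E Z <= 1 such that, with s = log2 (1 + Z), almost surely and for all
    f, g of the n-th net,
      U(f,g) <= C alpha d(f,g) (sqrt (N (4^n + s)) + 4^n + s),
      sum_i (f - g)^2(X_i) <= C d(f,g)^2 (N + 4^n + s).
    The chaining is then pathwise. It starts at the level a with 4^a ~ s, uses
    the first bound while 4^n <= N and, beyond, the Euclidean norm: the tail of
    the chain has norm at most C gamma2, and f^2 - g^2 = (f - g)^2 + 2 g (f - g).

    The tail bound for u >= 1 is Markov's inequality for Z. For u < 1 a constant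
    factor in front of the exponential is not allowed. If alpha^2 / sqrt N is at
    most the chaining term, the latter absorbs the deviation of the case u = 1.
    Otherwise the chain is started at level 0, so that the supremum is at most
    U(f0,0) / N plus C (1 + s) times the chaining term, and Chernoff's bound at
    a parameter of order u uses that U(f0,0) is centred. *)

(** * Expectations of products of independent variables *)

(** Bernstein's inequality cannot serve on all levels: its linear term [alpha d(f,g) 4^n] is not
    summable, as gamma2 controls only [2^n d(f,g)]. While [4^n <= N], [4^n] is at most [sqrt N 2^n].
    Beyond, a link has Euclidean norm of order [d(f,g) sqrt (N + 4^n)], hence [2^n d(f,g)], but the
    centring is lost. The change of the means is then of order [N alpha d(f, F_b)] at the switching
    level [b], and [N <= sqrt N 2^b] turns this into [sqrt N alpha gamma2]. Starting at level [a]
    costs [2^a alpha gamma2], which the arithmetic-geometric inequality splits into [s alpha^2] and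
    [gamma2^2]. Only a sequence [f_j] given by separability is chained. Its members lie in no net in
    general, so [Z] also controls the pairs formed by [f_j] and its nearest point in the n-th net,
    for [j <= n]. For [u < 1], [U(f0,0)] and [s] are dependent, and the arithmetic-geometric
    inequality separates their exponentials. That of a small multiple of [s] is [(1 + Z)^p] with
    [p <= 1], of expectation at most [1 + p]; spare copies of the chaining term in the constant
    cancel the excess. *)

Section ge0_expectation.
Context {R : realType} {dO : measure_display} {Omega : measurableType dO}
  (P : probability Omega R).
Implicit Types f g : Omega -> R.

Lemma ge0_expectationZl f (k : R) : measurable_fun setT f ->
  (forall w, 0 <= f w) -> 0 <= k ->
  ('E_P[fun w => (k * f w)%R] = k%:E * 'E_P[f])%E.
Proof.
move=> mf f0 k0; rewrite unlock -ge0_integralZl_EFin//.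
- by move=> w _; rewrite lee_fin.
- exact/measurable_EFinP.
Qed.

Lemma ge0_expectationD f g : measurable_fun setT f -> measurable_fun setT g ->
  (forall w, 0 <= f w) -> (forall w, 0 <= g w) ->
  ('E_P[fun w => (f w + g w)%R] = 'E_P[f] + 'E_P[g])%E.
Proof.
move=> mf mg f0 g0; rewrite unlock -ge0_integralD//.
- by move=> w _; rewrite lee_fin.
- exact/measurable_EFinP.
- by move=> w _; rewrite lee_fin.
- exact/measurable_EFinP.
Qed.

Lemma ge0_expectation_le f g : measurable_fun setT f -> measurable_fun setT g ->
  (forall w, 0 <= f w) -> (forall w, f w <= g w) -> ('E_P[f] <= 'E_P[g])%E.
Proof.
move=> mf mg f0 fg; apply: expectation_le => //.
- by move=> w; exact: le_trans (fg w).
- exact: aeW.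
Qed.

Lemma ge0_expectation_sum (I : Type) (r : seq I) (f : I -> Omega -> R) :
  (forall i, measurable_fun setT (f i)) -> (forall i w, 0 <= f i w) ->
  ('E_P[fun w => (\sum_(i <- r) f i w)%R] = \sum_(i <- r) 'E_P[f i])%E.
Proof.
move=> mf f0; rewrite unlock.
under eq_integral do rewrite -sumEFin.
rewrite ge0_integral_sum//.
- by move=> i; exact/measurable_EFinP.
- by move=> i w _; rewrite lee_fin.
Qed.

Lemma measurable_superlevel f (a : R) : measurable_fun setT f ->
  measurable [set w | a <= f w].
Proof.
move=> mf; rewrite (_ : [set w | _] = setT `&` f @^-1` `[a, +oo[).
  exact: mf.
by rewrite setTI; apply/seteqP; split => w /=; rewrite in_itv/= andbT.
Qed.

Lemma ge0_markov f (a : R) : measurable_fun setT f -> (forall w, 0 <= f w) ->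
  0 < a -> (P [set w | (a <= f w)%R] <= (a^-1)%:E * 'E_P[f])%E.
Proof.
move=> mf f0 a0.
have mA := measurable_superlevel a mf.
rewrite -ge0_expectationZl//; last by rewrite invr_ge0 ltW.
rewrite -(expectation_indic P mA); apply: ge0_expectation_le => //.
- exact: measurable_funM.
- move=> w; rewrite indicE; have [/set_mem/= aw|_] := boolP (w \in _).
    by rewrite ler_pdivlMl// mulr1.
  by rewrite mulr_ge0// invr_ge0 ltW.
Qed.

End ge0_expectation.

Section product_rule.
Context {R : realType} {dO dX : measure_display} {Omega : measurableType dO}
  {TX : measurableType dX} (P : probability Omega R).

Import HBNNSimple.

(** Both sides are monotone limits along simple functions, for which the hypothesis on indicators
    suffices. Finiteness of [c] lets it pass through sums and the limit. In the use below, [G]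
    collects the other factors of a product. *)
Lemma expectation_mul_comp (G : Omega -> R) (Y : Omega -> TX) (c : \bar R)
    (phi : TX -> R) :
  (forall w, 0 <= G w) -> measurable_fun setT G -> measurable_fun setT Y ->
  c \is a fin_num ->
  (forall E, measurable E ->
     ('E_P[fun w => (G w * \1_E (Y w))%R] = c * P (Y @^-1` E))%E) ->
  (forall x, 0 <= phi x) -> measurable_fun setT phi ->
  ('E_P[fun w => (G w * phi (Y w))%R] = c * 'E_P[phi \o Y])%E.
Proof.
move=> G0 mG mY cfin GE phi0 mphi.
have mphi' : measurable_fun setT (EFin \o phi) by exact/measurable_EFinP.
pose h := nnsfun_approx measurableT mphi'.
have hcvg x : (h n x)%:E @[n --> \oo] --> (phi x)%:E.
  by apply: cvg_nnsfun_approx => // y _; rewrite lee_fin.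
have hnd x m n : (m <= n)%N -> h m x <= h n x.
  by move=> mn; exact/lefP/nd_nnsfun_approx.
have mh n : measurable_fun setT (h n \o Y) by exact: measurableT_comp.
have hn n : ('E_P[fun w => (G w * h n (Y w))%R] = c * 'E_P[h n \o Y])%E.
  have ind r : measurable (h n @^-1` [set r]) by [].
  have mind r : measurable_fun setT (fun w => \1_(h n @^-1` [set r]) (Y w) : R).
    by apply: measurableT_comp => //; exact: measurable_indic.
  have ind0 r w : 0 <= \1_(h n @^-1` [set r]) (Y w) :> R.
    by rewrite indicE; case: (_ \in _).
  (* The absolute value only makes every term of the sum nonnegative. *)
  have hsum w : h n (Y w) =
      \sum_(y <- fset_set (range (h n))) `|y| * \1_(h n @^-1` [set y]) (Y w).
    rewrite {1}fimfunE fsbig_finite//= !big_seq; apply: eq_bigr => y.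
    by rewrite in_fset_set// => /set_mem [x _ <-]; rewrite ger0_norm.
  rewrite (_ : h n \o Y = fun w => \sum_(y <- fset_set (range (h n)))
      `|y| * \1_(h n @^-1` [set y]) (Y w)); last by apply/funext => w; exact: hsum.
  rewrite (_ : (fun w => _) = fun w => \sum_(y <- fset_set (range (h n)))
      `|y| * (G w * \1_(h n @^-1` [set y]) (Y w))); last first.
    apply/funext => w; rewrite hsum mulr_sumr; apply: eq_bigr => y _.
    by rewrite mulrCA.
  rewrite (ge0_expectation_sum _ _ (f := fun y w =>
    `|y| * (G w * \1_(h n @^-1` [set y]) (Y w)))); last 2 first.
  - by move=> y; apply: measurable_funM => //; exact: measurable_funM.
  - by move=> y w; rewrite !mulr_ge0.
  rewrite (ge0_expectation_sum _ _ (f := fun y w =>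
    `|y| * \1_(h n @^-1` [set y]) (Y w))); last 2 first.
  - by move=> y; exact: measurable_funM.
  - by move=> y w; rewrite mulr_ge0.
  rewrite fin_num_sume_distrr//; last first.
    move=> y z _ _; apply: ge0_adde_def; rewrite inE;
    by apply: expectation_ge0 => w; rewrite mulr_ge0.
  apply: eq_bigr => y _.
  rewrite !ge0_expectationZl//; last 2 first.
  - exact: measurable_funM.
  - by move=> w; exact: mulr_ge0.
  rewrite GE// muleCA; congr (_ * (_ * _))%E.
  rewrite -expectation_indic//.
  rewrite -[X in measurable X]setTI; exact: mY.
rewrite unlock in hn *.
transitivity (limn (fun n => \int[P]_w (G w * h n (Y w))%:E)%E).
  rewrite -monotone_convergence//.
  - apply: eq_integral => w _; apply/esym/cvg_lim => //.
    under eq_fun do rewrite EFinM.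
    by rewrite EFinM; apply: cvgeZl.
  - move=> n; apply/measurable_EFinP; apply: measurable_funM => //; exact: mh.
  - by move=> n w _; rewrite lee_fin mulr_ge0.
  - by move=> w _ m n mn; rewrite lee_fin ler_wpM2l// hnd.
under eq_fun do rewrite hn.
have -> : (\int[P]_w ((phi \o Y) w)%:E =
    limn (fun n => \int[P]_w ((h n \o Y) w)%:E))%E.
  rewrite -monotone_convergence//.
  - by apply: eq_integral => w _; apply/esym/cvg_lim => //; exact: hcvg.
  - by move=> n; apply/measurable_EFinP; exact: mh.
  - by move=> n w _; rewrite lee_fin /=.
  - by move=> w _ m n mn; rewrite lee_fin /= hnd.
rewrite limeMl//.
apply: ereal_nondecreasing_is_cvgn => m n mn; apply: ge0_le_integral => //.
- by move=> w _; rewrite lee_fin /=.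
- by apply/measurable_EFinP; exact: mh.
- by apply/measurable_EFinP; exact: mh.
- by move=> w _; rewrite lee_fin /= hnd.
Qed.

(** Indicators are replaced by arbitrary functions one coordinate at a time: in [S k], the factors
    of index at least [k] are still indicators. [S 0] is the product rule and [S N] the claim. *)
Lemma expectation_prod_independent (N : nat) (X : 'I_N -> {RV P >-> TX})
    (phi : 'I_N -> TX -> R) :
  mutually_independent P X ->
  (forall i x, 0 <= phi i x) -> (forall i, measurable_fun setT (phi i)) ->
  (forall i, 'E_P[phi i \o X i] < +oo)%E ->
  ('E_P[fun w => (\prod_i phi i (X i w))%R] = \prod_i 'E_P[phi i \o X i])%E.
Proof.
move=> indep.
suff S k : forall psi : 'I_N -> TX -> R,
    (forall i : 'I_N, (k <= i)%N -> exists2 E, measurable E & psi i = \1_E) ->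
    (forall i x, 0 <= psi i x) -> (forall i, measurable_fun setT (psi i)) ->
    (forall i, 'E_P[psi i \o X i] < +oo)%E ->
    ('E_P[fun w => (\prod_i psi i (X i w))%R] = \prod_i 'E_P[psi i \o X i])%E.
  by apply: (S N) => i; rewrite leqNgt ltn_ord.
have mX (i : 'I_N) E : measurable E -> measurable (X i @^-1` E).
  move=> mE; rewrite -[X in measurable X]setTI.
  exact: (measurable_funP (X i)).
have intX (i : 'I_N) (E : set TX) : measurable E ->
    ('E_P[(\1_E : TX -> R) \o X i] = P (X i @^-1` E))%E.
  by move=> mE; rewrite -expectation_indic//; exact: mX.
elim: k => [|k ih] psi.
  move=> /(_ _ isT) psiE _ _ _.
  have /boolp.choice[E EP] : forall i, exists E, measurable E /\ psi i = \1_E.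
    by move=> i; have [E mE ->] := psiE i; exists E.
  rewrite (_ : (fun w => _) = \1_(\bigcap_(i in [set` [set: 'I_N]%SET])
      (X i @^-1` E i))); last first.
    apply/funext => w; rewrite indicE.
    have [/set_mem wE|/negP wE] := boolP (_ \in _).
      rewrite big1// => i _; have [_ ->] := EP i; rewrite indicE mem_set//.
      by apply: wE => /=; rewrite inE.
    have [i wEi] : exists i, ~ E i (X i w).
      apply/not_existsP => H; apply: wE; apply/mem_set => i _ /=.
      exact: contrapT (H i).
    rewrite (bigD1 i)//=; have [_ ->] := EP i.
    by rewrite indicE memNset// mul0r.
  rewrite expectation_indic; last first.
    by apply: fin_bigcap_measurable => // i _; apply: mX; case: (EP i).
  rewrite indep; last by move=> i; case: (EP i).
  rewrite (eq_bigl xpredT); last by move=> i; rewrite inE.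
  by apply: eq_bigr => i _; have [mE ->] := EP i; rewrite intX.
move=> psiE psi0 mpsi psioo.
have [kN|Nk] := ltnP k N; last first.
  by apply: ih => // i ki; have := ltn_ord i; rewrite ltnNge (leq_trans Nk ki).
pose j := Ordinal kN.
pose G w := \prod_(i | i != j) psi i (X i w).
have mXpsi i : measurable_fun setT (fun w => psi i (X i w)).
  exact: measurableT_comp.
rewrite (_ : (fun w => _) = fun w => G w * psi j (X j w)); last first.
  by apply/funext => w; rewrite (bigD1 j)//= mulrC.
rewrite [RHS](bigD1 j)//= muleC.
apply: expectation_mul_comp => //.
- by move=> w; rewrite prodr_ge0.
- rewrite /G; under eq_fun do rewrite -big_filter.
  by apply: measurable_prod => i _; exact: mXpsi.
- by apply: prode_fin_num => i _; rewrite ge0_fin_numE// expectation_ge0//= => w.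
- move=> E mE.
  (* With an indicator at [j] the product falls under the induction hypothesis, which is the test on
     indicators that [expectation_mul_comp] asks for. *)
  have := ih (fun i => if i == j then \1_E else psi i).
  rewrite (bigD1 j)//= eqxx intX// muleC.
  under [X in (X * _)%E]eq_bigr => i /negbTE -> do [].
  move=> <-.
  + congr (expectation P _); apply/funext => w.
    rewrite (bigD1 j)//= eqxx mulrC; congr (_ * _).
    by apply: eq_bigr => i /negbTE ->.
  + move=> i ki; case: eqP => [_|/eqP ij]; first by exists E.
    apply: psiE; rewrite ltn_neqAle ki andbT; apply: contra ij => /eqP ki'.
    by apply/eqP/val_inj.
  + by move=> i x; case: ifP => // _; rewrite indicE; case: (_ \in _).
  + by move=> i; case: ifP => // _; exact: measurable_indic.
  + move=> i; case: eqP => // _; rewrite intX//.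
    by rewrite (le_lt_trans (probability_le1 _ _))//; [exact: mX|rewrite ltry].
Qed.

End product_rule.

(** * Exponential moments *)

Section exponential_inequalities.
Context {R : realType}.

Lemma expR_tangent (m t : R) : expR m * (1 + (t - m)) <= expR t.
Proof.
have -> : expR t = expR m * expR (t - m) by rewrite -expRD addrC subrK.
by apply: ler_wpM2l; rewrite ?expR_ge0// expR_ge1Dx.
Qed.

(** The tangents at the weighted mean [m] bound the three exponentials from below; averaged with
    weights 1/2, 1/4, 1/4, their linear parts cancel. *)
Lemma expR_convex (x y z : R) :
  expR (x / 2 + y / 4 + z / 4) <= 2^-1 * expR x + 4^-1 * expR y + 4^-1 * expR z.
Proof.
set m := x / 2 + y / 4 + z / 4.
have := expR_tangent m x; have := expR_tangent m y; have := expR_tangent m z.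
have := expR_gt0 m; set e := expR m => e0.
have : m = x / 2 + y / 4 + z / 4 by [].
by nra.
Qed.

(** Bernoulli's inequality [x^p <= 1 + p (x - 1)] at [x = e^L]: the tangent at [p L], taken at [L]
    and 0 with weights [p] and [1 - p]. It later bounds [E (1 + Z)^p]. *)
Lemma bernoulli_expR (L p : R) : 0 <= p <= 1 ->
  expR (p * L) <= 1 + p * (expR L - 1).
Proof.
move=> /andP[p0 p1]; set m := p * L.
have := ler_wpM2l p0 (expR_tangent m L).
have p1' : 0 <= 1 - p by lra.
have := ler_wpM2l p1' (expR_tangent m 0); rewrite expR0.
have -> : (1 - p) * (expR m * (1 + (0 - m))) =
  expR m - p * (expR m * (1 + (L - m))) by rewrite /m; ring.
by lra.
Qed.

(** [e^(-x) >= 1 - x] gives [e^x <= 1 + x e^x]. For [x >= 0] this is inserted into itself; for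
    [x < 0], [x e^x <= x (1 + x)]. *)
Lemma expR_le_quadratic (x : R) : expR x <= 1 + x + x ^+ 2 * expR `|x|.
Proof.
have e1 : expR x <= 1 + x * expR x.
  have := expR_ge1Dx (- x); rewrite expRN => h.
  have := expR_gt0 x => e0.
  rewrite -lerBlDr -{1}[expR x]mul1r -mulrBl -ler_pdivlMr//.
  by rewrite mul1r; exact: h.
have [x0|x0] := leP 0 x.
  rewrite ger0_norm//; apply: (le_trans e1); rewrite -addrA lerD2l.
  by have := ler_wpM2l x0 e1; rewrite mulrDr mulr1 mulrA -expr2.
apply: (le_trans e1); rewrite -addrA lerD2l.
have h1 : x ^+ 2 <= x ^+ 2 * expR `|x|.
  by rewrite ler_peMr ?sqr_ge0// -expR0 ler_expR.
apply: le_trans (lerD (lexx x) h1).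
have := expR_ge1Dx x; rewrite expr2; nra.
Qed.

Lemma sqr_le_expR (x : R) : 0 <= x -> x ^+ 2 <= 16 * expR (x / 2).
Proof.
move=> x0; have := expR_ge1Dx (x / 4) => h.
have -> : expR (x / 2) = expR (x / 4) ^+ 2 by rewrite -expRM_natl; congr expR; field.
by rewrite !expr2; nra.
Qed.

End exponential_inequalities.

Section exponential_moments.
Context {R : realType} {dO : measure_display} {Omega : measurableType dO}
  (P : probability Omega R).

Definition exp_moment_bound : R := 2 * expR (2^-1) / (1 - expR (- 2^-1)).

Let q_gt0 : 0 < expR (- 2^-1) :> R. Proof. exact: expR_gt0. Qed.

Let q_lt1 : expR (- 2^-1) < 1 :> R.
Proof. by rewrite expR_lt1 oppr_lt0 invr_gt0. Qed.

Lemma exp_moment_bound_ge1 : 1 <= exp_moment_bound.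
Proof.
rewrite /exp_moment_bound ler_pdivlMr ?subr_gt0// mul1r.
have : 1 <= expR 2^-1 :> R by rewrite -expR0 ler_expR invr_ge0.
by move: q_gt0; lra.
Qed.

(* [e^(T/2) <= sum_k e^((k+1)/2) 1_{T >= k}], since the term of index [floor T]
   suffices; integrating gives the geometric series [exp_moment_bound]. *)
Lemma expectation_exp_half (T : Omega -> R) :
  measurable_fun setT T -> (forall w, 0 <= T w) ->
  (forall t, 0 < t -> (P [set w | (t <= T w)%R] <= (2 * expR (- t))%:E)%E) ->
  ('E_P[fun w => expR (T w / 2)] <= exp_moment_bound%:E)%E.
Proof.
move=> mT T0 tail.
pose A (k : nat) := [set w | k%:R <= T w].
have mA k : measurable (A k) by exact: measurable_superlevel.
pose g k w : R := expR (k.+1%:R / 2) * \1_(A k) w.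
have g0 k w : 0 <= g k w by rewrite mulr_ge0 ?expR_ge0.
have mg k : measurable_fun setT (g k).
  by apply: measurable_funM => //; exact: measurable_indic.
have mexp : measurable_fun setT (fun w => expR (T w / 2)).
  by apply: measurableT_comp => //; exact: measurable_funM.
have le_series w : ((expR (T w / 2))%:E <= \sum_(0 <= k <oo) (g k w)%:E)%E.
  pose n := Num.trunc (T w).
  have /andP[nT Tn] : n%:R <= T w < n.+1%:R by exact: truncn_itv.
  apply: (le_trans _ (nneseries_lim_ge n.+1 _)); last first.
    by move=> k _ _; rewrite lee_fin.
  rewrite big_nat_recr//= -[leLHS]add0e leeD//.
    by apply: sume_ge0 => k _; rewrite lee_fin.
  rewrite lee_fin /g indicE mem_set// mulr1 ler_expR ler_pM2r ?invr_gt0//.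
  exact: ltW.
rewrite unlock.
apply: (@le_trans _ _ (\int[P]_w (\sum_(0 <= k <oo) (g k w)%:E))%E).
  apply: ge0_le_integral => //.
  - exact/measurable_EFinP.
  - apply: ge0_emeasurable_sum => [k w _ _|k _]; first by rewrite lee_fin.
    exact/measurable_EFinP.
rewrite integral_nneseries//; last 2 first.
- by move=> k; exact/measurable_EFinP.
- by move=> k w _; rewrite lee_fin.
have termE k : (\int[P]_w (g k w)%:E <=
    (2 * expR 2^-1 * expR (- 2^-1) ^+ k)%:E)%E.
  have -> : (\int[P]_w (g k w)%:E = (expR (k.+1%:R / 2))%:E * P (A k))%E.
    under eq_integral do rewrite EFinM.
    rewrite ge0_integralZl_EFin ?expR_ge0//; last first.
      exact/measurable_EFinP/measurable_indic.
    by rewrite integral_indic// setIT.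
  apply: (@le_trans _ _ ((expR (k.+1%:R / 2))%:E * (2 * expR (- k%:R))%:E)%E).
    apply: lee_wpmul2l; first by rewrite lee_fin expR_ge0.
    (* The tail hypothesis needs [t > 0]; for [k = 0] a probability is at most 2 anyway. *)
    have [->|k0] := eqVneq k 0%N; last by apply: tail; rewrite ltr0n lt0n.
    by rewrite oppr0 expR0 mulr1 (le_trans (probability_le1 _ _))// lee_fin ler1n.
  rewrite -EFinM lee_fin mulrCA -expRD -expRM_natl -mulrA -expRD.
  rewrite le_eqVlt; apply/orP; left; apply/eqP; congr (_ * expR _).
  by rewrite -natr1; field.
apply: (@le_trans _ _ (\sum_(0 <= k <oo)
    (2 * expR 2^-1 * expR (- 2^-1) ^+ k)%:E)%E).
  apply: lee_nneseries => [k _ _|k _ //].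
  by apply: integral_ge0 => w _; rewrite lee_fin.
apply: lime_le.
  apply: is_cvg_nneseries => k _ _.
  by rewrite lee_fin !mulr_ge0 ?exprn_ge0 ?expR_ge0.
apply: nearW => n; rewrite sumEFin lee_fin -mulr_sumr.
rewrite /exp_moment_bound ler_pM2l ?mulr_gt0 ?expR_gt0//.
have := geometric_seriesE 1 (negbT (lt_eqF q_lt1)).
move=> /(congr1 (fun f => f n)); rewrite /series/= /geometric/=.
under eq_bigr do rewrite mul1r.
by move=> ->; rewrite mul1r ler_pdivrMr ?subr_gt0// mulVf ?subr_eq0 ?gt_eqF//.
Qed.

(** For [s > 0], [u = s sqrt t] turns the tail into that of [expectation_exp_half]. For [s = 0],
    division by zero makes the exponent 0 and the integrand 1. *)
Lemma gauss_exp_moment (h : Omega -> R) (s : R) : measurable_fun setT h ->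
  0 <= s ->
  (forall u, 0 < u ->
    (P [set w | (u <= `|h w|)%R] <= (2 * gauss_tail u s)%:E)%E) ->
  ('E_P[fun w => expR (h w ^+ 2 / s ^+ 2 / 2)] <= exp_moment_bound%:E)%E.
Proof.
move=> mh; rewrite le_eqVlt => /predU1P[<- _|s0 tail].
  under [X in expectation P X]eq_fun do
    rewrite expr0n/= invr0 mulr0 mul0r expR0.
  by rewrite expectation_cst lee_fin exp_moment_bound_ge1.
apply: expectation_exp_half.
- by apply: measurable_funM => //; exact: measurable_funX.
- by move=> w; rewrite divr_ge0 ?sqr_ge0.
- move=> t t0; have ts : 0 < s * Num.sqrt t by rewrite mulr_gt0 ?sqrtr_gt0.
  rewrite (_ : [set w | _] = [set w | s * Num.sqrt t <= `|h w|]).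
    rewrite (le_trans (tail _ ts))// lee_fin /gauss_tail gt_eqF//.
    rewrite (_ : _ / _ = t)//.
    by rewrite exprMn sqr_sqrtr ?ltW// mulrC mulKf// expf_neq0// gt_eqF.
  have st2 : t * s ^+ 2 = (s * Num.sqrt t) ^+ 2.
    by rewrite exprMn sqr_sqrtr ?ltW// mulrC.
  apply/seteqP; split => w /=;
    rewrite ler_pdivlMr ?exprn_gt0// st2 -(real_normK (num_real (h w)));
    by rewrite ler_sqr ?nnegrE// ltW.
Qed.

(** Second-order expansion of the exponential: the linear term integrates to [l (ma - mb)], which
    the centring cancels after [1 + y <= e^y], and [l K <= 1/2] leaves enough of [e^(|a - b| / K)]
    to absorb the square. *)
Lemma centered_mgf (a b : Omega -> R) (ma mb C K l : R) :
  measurable_fun setT a -> measurable_fun setT b ->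
  (forall w, 0 <= a w) -> (forall w, 0 <= b w) ->
  ('E_P[a] = ma%:E)%E -> ('E_P[b] = mb%:E)%E -> 0 < K ->
  ('E_P[fun w => (expR (`|a w - b w| / K))%R] <= C%:E)%E ->
  0 <= l -> l * K <= 2^-1 ->
  ('E_P[fun w => (expR (l * (a w - b w - (ma - mb))))%R] <=
    (expR (16 * C * l ^+ 2 * K ^+ 2))%:E)%E.
Proof.
move=> m_a m_b a0 b0 Ea Eb K0 EC l0 lK.
have me : measurable_fun setT (fun w => expR (`|a w - b w| / K)).
  apply: measurableT_comp => //; apply: measurable_funM => //.
  by apply: measurableT_comp => //; exact: measurable_funB.
have ml : measurable_fun setT (fun w => expR (l * (a w - b w))).
  apply: measurableT_comp => //; apply: measurable_funM => //.
  exact: measurable_funB.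
pose c := 16 * l ^+ 2 * K ^+ 2.
have c0 : 0 <= c by rewrite mulr_ge0 ?sqr_ge0// mulr_ge0 ?sqr_ge0.
(* [l * b w] stands on the left so that all terms are nonnegative and only expectations of
   nonnegative functions occur. *)
have pw w : expR (l * (a w - b w)) + l * b w <=
    (1 + l * a w) + c * expR (`|a w - b w| / K).
  have := expR_le_quadratic (l * (a w - b w)).
  set y := `|a w - b w| / K.
  have y0 : 0 <= y by rewrite divr_ge0// ltW.
  have absE : `|l * (a w - b w)| = l * K * y.
    by rewrite normrM (ger0_norm l0) /y; field; rewrite gt_eqF.
  have sqE : (l * (a w - b w)) ^+ 2 = l ^+ 2 * K ^+ 2 * y ^+ 2.
    by rewrite -[LHS]real_normK ?num_real// absE !exprMn.
  rewrite sqE absE => h.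
  have h2 : y ^+ 2 * expR (l * K * y) <= 16 * expR y.
    have -> : expR y = expR (y / 2) * expR (y / 2).
      by rewrite -expRD; congr expR; field.
    rewrite mulrA; apply: ler_pM.
    - exact: sqr_ge0.
    - exact: expR_ge0.
    - exact: sqr_le_expR.
    - by rewrite ler_expR [leRHS]mulrC ler_wpM2r.
  have h3 : l ^+ 2 * K ^+ 2 * (y ^+ 2 * expR (l * K * y)) <=
      l ^+ 2 * K ^+ 2 * (16 * expR y).
    by apply: ler_wpM2l => //; rewrite mulr_ge0 ?sqr_ge0.
  by rewrite /c; nra.
have mla : measurable_fun setT (fun w => l * a w) by exact: measurable_funM.
have mlb : measurable_fun setT (fun w => l * b w) by exact: measurable_funM.
have E1 : ('E_P[fun w => (expR (l * (a w - b w)))%R] + (l * mb)%:E <=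
    (1 + l * ma + c * C)%:E)%E.
  rewrite EFinM -Eb -ge0_expectationZl// -ge0_expectationD//; last first.
    by move=> w; rewrite mulr_ge0.
  apply: (le_trans (ge0_expectation_le _ _ _ _ pw)).
  - by apply: measurable_funD.
  - apply: measurable_funD; first by apply: measurable_funD.
    by apply: measurable_funM.
  - by move=> w; rewrite addr_ge0 ?expR_ge0// mulr_ge0.
  rewrite ge0_expectationD; last 4 first.
  - by apply: measurable_funD.
  - by apply: measurable_funM.
  - by move=> w; rewrite addr_ge0// mulr_ge0.
  - by move=> w; rewrite mulr_ge0// expR_ge0.
  rewrite ge0_expectationD//; last by move=> w; rewrite mulr_ge0.
  rewrite !ge0_expectationZl//.
  rewrite Ea EFinD EFinD EFinM (EFinM c) expectation_cst leeD2l//.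
  by rewrite lee_wpmul2l// lee_fin.
rewrite (_ : (fun w => _) = fun w => expR (- (l * (ma - mb))) *
    expR (l * (a w - b w))); last first.
  by apply/funext => w; rewrite -expRD; congr expR; ring.
rewrite ge0_expectationZl ?expR_ge0//.
have E2 : ('E_P[fun w => (expR (l * (a w - b w)))%R] <=
    (1 + l * (ma - mb) + c * C)%:E)%E.
  move: E1; rewrite -leeBrDr// => /le_trans; apply; rewrite -EFinB lee_fin.
  by rewrite le_eqVlt; apply/orP; left; apply/eqP; ring.
have eg0 := expR_gt0 (- (l * (ma - mb))).
rewrite -lee_pdivlMl// (le_trans E2)// -EFinM lee_fin -expRN opprK -expRD.
apply: le_trans (expR_ge1Dx _).
by rewrite le_eqVlt; apply/orP; left; apply/eqP; rewrite /c; ring.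
Qed.

End exponential_moments.
(** * Increments of the squared process *)

Section subgaussian_process.
Context {R : realType} {dO dX : measure_display} {Omega : measurableType dO}
  {TX : measurableType dX} (P : probability Omega R) (N : nat)
  (X : 'I_N -> {RV P >-> TX}).

Implicit Types f g : TX -> R.

Definition mean_sq f (i : 'I_N) : R :=
  fine ('E_P[fun w => (f (X i w) ^+ 2)%R])%E.

(** [U(f,g)] of the overview; with [g = cst 0] it is [N] times the quantity under the supremum. *)
Definition csq f g (w : Omega) : R :=
  \sum_i (f (X i w) ^+ 2 - g (X i w) ^+ 2 - (mean_sq f i - mean_sq g i)).

Definition dsq f g (w : Omega) : R := \sum_i (f (X i w) - g (X i w)) ^+ 2.

Lemma csqxx f w : csq f f w = 0.
Proof. by rewrite /csq big1// => i _; rewrite !subrr. Qed.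

Lemma csq_trans g f h w : csq f h w = csq f g w + csq g h w.
Proof. by rewrite /csq -big_split/=; apply: eq_bigr => i _; ring. Qed.

Context (G : set (TX -> R)) (d : (TX -> R) -> (TX -> R) -> R) (alpha : R).
Context (N_gt0 : (0 < N)%N) (indep : mutually_independent P X)
  (mG : forall f, G f -> measurable_fun setT f) (distG : is_distance G d)
  (tailG : forall f g, G f -> G g -> forall (i : 'I_N) (u : R), 0 < u ->
     (P [set w | (u <= `|f (X i w) - g (X i w)|)%R] <=
       (2 * gauss_tail u (d f g))%:E)%E)
  (G0 : G (cst 0)) (dG_le : forall f, G f -> d f (cst 0) <= alpha).

Local Notation C0 := (exp_moment_bound : R).
Local Notation C1 := (16 * exp_moment_bound : R).

Let C0_ge1 : 1 <= C0 := exp_moment_bound_ge1.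
Let C0_gt0 : 0 < C0 := lt_le_trans ltr01 C0_ge1.
Let C0_ge0 : 0 <= C0 := ltW C0_gt0.

Let mfX f (i : 'I_N) : G f -> measurable_fun setT (fun w => f (X i w)).
Proof. by move=> Gf; apply: measurableT_comp => //; exact: mG. Qed.

Let mfX2 f (i : 'I_N) : G f -> measurable_fun setT (fun w => f (X i w) ^+ 2).
Proof. by move=> Gf; apply: measurable_funX; exact: mfX. Qed.

Lemma dist_ge0 f g : G f -> G g -> 0 <= d f g.
Proof. by move=> Gf Gg; exact: distance_ge0 distG _ _ Gf Gg. Qed.

Lemma dist_eq0 f g : G f -> G g -> d f g = 0 -> f = g.
Proof. by move=> Gf Gg; exact: (distance_eq0 distG Gf Gg).1. Qed.

Lemma dist_alpha_ge0 : 0 <= alpha.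
Proof. exact: le_trans (dist_ge0 G0 G0) (dG_le G0). Qed.

Lemma diff_exp_moment f g i : G f -> G g ->
  ('E_P[fun w => (expR ((f (X i w) - g (X i w)) ^+ 2 / d f g ^+ 2 / 2))%R] <=
    C0%:E)%E.
Proof.
move=> Gf Gg; apply: gauss_exp_moment.
- by apply: measurable_funB; exact: mfX.
- exact: dist_ge0.
- by move=> u u0; exact: tailG.
Qed.

(** [mean_sq] is defined through [fine], so finiteness is due: [x <= 2 s e^(x / (2 s))] bounds the
    second moment by the exponential moment of [diff_exp_moment]. *)
Lemma sq_expectation f i : G f ->
  ('E_P[fun w => (f (X i w) ^+ 2)%R] = (mean_sq f i)%:E)%E.
Proof.
move=> Gf; rewrite fineK// ge0_fin_numE; last first.
  by apply: expectation_ge0 => w; exact: sqr_ge0.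
have [df0|df0] := eqVneq (d f (cst 0)) 0.
  rewrite (dist_eq0 Gf G0 df0).
  rewrite (_ : (fun w => _) = cst 0) ?expectation_cst ?ltry//.
  by apply/funext => w /=; rewrite expr0n.
have ds0 : 0 < d f (cst 0) ^+ 2 by rewrite exprn_gt0// lt_def df0 dist_ge0.
set s := _ ^+ 2 in ds0.
have me : measurable_fun setT
    (fun w => expR ((f (X i w) - cst 0 (X i w)) ^+ 2 / s / 2)).
  apply: measurableT_comp => //; apply: measurable_funM => //.
  apply: measurable_funM => //; apply: measurable_funX.
  by apply: measurable_funB; exact: mfX.
apply: (@le_lt_trans _ _ (2 * s * C0)%:E); last exact: ltry.
rewrite EFinM.
apply: le_trans (lee_wpmul2l _ (diff_exp_moment i Gf G0)); last first.
  by rewrite lee_fin mulr_ge0// ltW.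
rewrite -ge0_expectationZl//; last by rewrite mulr_ge0// ltW.
apply: ge0_expectation_le => //.
- exact: mfX2.
- by apply: measurable_funM.
- by move=> w; exact: sqr_ge0.
- move=> w /=; rewrite subr0 -/s.
  set x := _ ^+ 2; have := expR_ge1Dx (x / s / 2).
  have xE : x = 2 * s * (x / s / 2) by field; rewrite gt_eqF.
  move=> h; rewrite {1}xE; apply: ler_wpM2l; first by rewrite mulr_ge0// ltW.
  by apply: le_trans h; rewrite lerDr.
Qed.

Lemma mean_sq_cst0 i : mean_sq (cst 0) i = 0.
Proof.
rewrite /mean_sq (_ : (fun w => _) = cst 0) ?expectation_cst//.
by apply/funext => w /=; rewrite expr0n.
Qed.

Definition bern_scale f g : R := 8 * alpha * d f g.

Lemma bern_scale_ge0 f g : G f -> G g -> 0 <= bern_scale f g.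
Proof.
by move=> Gf Gg; rewrite mulr_ge0 ?dist_ge0// mulr_ge0 ?dist_alpha_ge0.
Qed.

(** If [alpha = 0], then [G] contains only the zero function. So a vanishing scale, where quotients
    by it are meaningless, always means a vanishing increment. *)
Lemma bern_scale_eq0 f g : G f -> G g -> bern_scale f g = 0 -> f = g.
Proof.
move=> Gf Gg /eqP; rewrite !mulf_eq0 pnatr_eq0/= => /orP[/eqP a0|/eqP]; last first.
  exact: dist_eq0.
have z h : G h -> h = cst 0.
  move=> Gh; apply: dist_eq0 => //; apply/eqP; rewrite eq_le dist_ge0// andbT.
  by have := dG_le Gh; rewrite a0.
by rewrite (z f)// (z g).
Qed.

Let sq_over_alpha f x : G f ->
  f x ^+ 2 / alpha ^+ 2 <= (f x - cst 0 x) ^+ 2 / d f (cst 0) ^+ 2.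
Proof.
move=> Gf; rewrite /= subr0.
have [df0|df0] := eqVneq (d f (cst 0)) 0.
  by rewrite (dist_eq0 Gf G0 df0)/= expr0n/= !mul0r.
have dp : 0 < d f (cst 0) by rewrite lt_def df0 dist_ge0.
apply: ler_wpM2l; first exact: sqr_ge0.
rewrite lef_pV2 ?posrE ?exprn_gt0//; last exact: lt_le_trans (dG_le Gf).
by rewrite ler_sqr ?nnegrE ?dist_alpha_ge0 ?dG_le// ltW.
Qed.

(** [a^2 - b^2 = (a - b)(a + b)] and the arithmetic-geometric inequality. The weights 1/2, 1/4, 1/4
    sum to 1, so [expR_convex] reduces the exponential moment of the increment to three moments
    bounded by [exp_moment_bound]. *)
Let sq_diff_le (a b s t : R) : 0 < s -> 0 < t ->
  `|a ^+ 2 - b ^+ 2| / (8 * t * s) <=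
  ((a - b) ^+ 2 / s ^+ 2 / 2) / 2 + (a ^+ 2 / t ^+ 2 / 2) / 4 +
  (b ^+ 2 / t ^+ 2 / 2) / 4.
Proof.
move=> s0 t0; pose p : R := `|a - b| / s; pose q : R := `|a| / t; pose r : R := `|b| / t.
have sqE (x y : R) : x ^+ 2 / y ^+ 2 = (`|x| / y) ^+ 2.
  by rewrite expr_div_n real_normK ?num_real.
rewrite !sqE -/p -/q -/r.
have p0 : 0 <= p by rewrite divr_ge0// ltW.
have : `|a ^+ 2 - b ^+ 2| <= (p * (q + r)) * (t * s).
  rewrite subr_sqr normrM.
  have -> : p * (q + r) * (t * s) = `|a - b| * (`|a| + `|b|).
    by rewrite /p /q /r; field; rewrite !gt_eqF.
  by apply: ler_wpM2l => //; exact: ler_normD.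
have ts0 : 0 < t * s by rewrite mulr_gt0.
rewrite -ler_pdivrMr// => h.
have -> : `|a ^+ 2 - b ^+ 2| / (8 * t * s) = `|a ^+ 2 - b ^+ 2| / (t * s) / 8.
  by field; rewrite !gt_eqF.
have amgm (x u v z : R) : z <= x * (u + v) ->
    z / 8 <= x ^+ 2 / 2 / 2 + u ^+ 2 / 2 / 4 + v ^+ 2 / 2 / 4.
  by have := sqr_ge0 (x - u); have := sqr_ge0 (x - v); nra.
exact: amgm h.
Qed.

Let mabs f g i : G f -> G g -> measurable_fun setT
  (fun w => expR (`|f (X i w) ^+ 2 - g (X i w) ^+ 2| / bern_scale f g)).
Proof.
move=> Gf Gg; apply: measurableT_comp => //; apply: measurable_funM => //.
by apply: measurableT_comp => //; apply: measurable_funB; exact: mfX2.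
Qed.

Lemma sq_diff_exp_moment f g i : G f -> G g ->
  ('E_P[fun w => (expR (`|f (X i w) ^+ 2 - g (X i w) ^+ 2| /
    bern_scale f g))%R] <= C0%:E)%E.
Proof.
move=> Gf Gg; have [/(bern_scale_eq0 Gf Gg) ->|K0] := eqVneq (bern_scale f g) 0.
  rewrite (_ : (fun w => _) = cst 1) ?expectation_cst ?lee_fin//.
  by apply/funext => w; rewrite subrr normr0 mul0r expR0.
have [s0 t0] : 0 < d f g /\ 0 < alpha.
  by move: K0; rewrite !mulf_eq0 negb_or => /andP[/norP[_ a0] d0];
    rewrite !lt_def a0 d0 dist_ge0// dist_alpha_ge0.
pose e h k w := expR ((h (X i w) - k (X i w)) ^+ 2 / d h k ^+ 2 / 2).
have me h k : G h -> G k -> measurable_fun setT (e h k).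
  move=> Gh Gk; apply: measurableT_comp => //; apply: measurable_funM => //.
  apply: measurable_funM => //; apply: measurable_funX.
  by apply: measurable_funB; exact: mfX.
have mce (c : R) h k : G h -> G k -> measurable_fun setT (fun w => c * e h k w).
  by move=> Gh Gk; apply: measurable_funM => //; exact: me.
have e0 (c : R) h k w : 0 <= c -> 0 <= c * e h k w.
  by move=> c0; rewrite mulr_ge0 ?expR_ge0.
have m3 : measurable_fun setT
    (fun w => 2^-1 * e f g w + 4^-1 * e f (cst 0) w).
  by apply: measurable_funD; exact: mce.
apply: (@le_trans _ _ ('E_P[fun w => (2^-1 * e f g w + 4^-1 * e f (cst 0) w +
    4^-1 * e g (cst 0) w)%R])%E).
  apply: ge0_expectation_le.
  - exact: mabs.
  - by apply: measurable_funD => //; exact: mce.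
  - by move=> w; exact: expR_ge0.
  - move=> w; apply: le_trans (expR_convex _ _ _); rewrite ler_expR.
    apply: le_trans (sq_diff_le _ _ s0 t0) _.
    apply: lerD; first apply: lerD => //.
    + by rewrite ler_pM2r// ler_pM2r//; exact: sq_over_alpha.
    + by rewrite ler_pM2r// ler_pM2r//; exact: sq_over_alpha.
rewrite ge0_expectationD//; last 3 first.
- exact: mce.
- by move=> w; rewrite addr_ge0// e0.
- by move=> w; rewrite e0.
rewrite ge0_expectationD//; last 4 first.
- exact: mce.
- exact: mce.
- by move=> w; rewrite e0.
- by move=> w; rewrite e0.
rewrite !ge0_expectationZl//; try exact: me; try by move=> w; exact: expR_ge0.
have -> : C0%:E = (2^-1%:E * C0%:E + 4^-1%:E * C0%:E + 4^-1%:E * C0%:E)%E.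
  by rewrite -!EFinM -!EFinD; congr EFin; field.
by apply: leeD; [apply: leeD|]; apply: lee_wpmul2l;
  rewrite ?lee_fin ?invr_ge0//; exact: diff_exp_moment.
Qed.

(** [x <= K e^(x / K)] at [K = bern_scale f g] bounds [f^2] by [g^2 + K e^(|f^2 - g^2| / K)]
    pointwise. Linearity in [d f g] is what the end of the chain and the passage to limits need. *)
Lemma mean_sq_diff_le f g i : G f -> G g ->
  mean_sq f i - mean_sq g i <= C0 * bern_scale f g.
Proof.
move=> Gf Gg; have [K0|K0] := eqVneq (bern_scale f g) 0.
  by rewrite K0 (bern_scale_eq0 Gf Gg K0) subrr mulr0.
have Kp : 0 < bern_scale f g by rewrite lt_def K0 bern_scale_ge0.
rewrite lerBlDl -lee_fin EFinD mulrC EFinM -!sq_expectation//.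
apply: le_trans (leeD (lexx _) (lee_wpmul2l _ (sq_diff_exp_moment i Gf Gg)));
  last by rewrite lee_fin ltW.
have mK : measurable_fun setT (fun w => bern_scale f g *
    expR (`|f (X i w) ^+ 2 - g (X i w) ^+ 2| / bern_scale f g)).
  by apply: measurable_funM => //; exact: mabs.
rewrite -ge0_expectationZl//; last 2 first.
- exact: mabs.
- exact: ltW.
rewrite -ge0_expectationD//; last 3 first.
- exact: mfX2.
- by move=> w; exact: sqr_ge0.
- by move=> w; rewrite mulr_ge0 ?expR_ge0// ltW.
apply: ge0_expectation_le.
- exact: mfX2.
- by apply: measurable_funD => //; exact: mfX2.
- by move=> w; exact: sqr_ge0.
- move=> w; set a := _ ^+ 2; set b := _ ^+ 2.
  rewrite -lerBlDl (le_trans (ler_norm _))// -ler_pdivrMl// mulrC.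
  by have := expR_ge1Dx (`|a - b| / bern_scale f g); lra.
Qed.

Lemma expectation_prod_le (phi : 'I_N -> TX -> R) (c : R) :
  (forall i x, 0 <= phi i x) -> (forall i, measurable_fun setT (phi i)) ->
  (forall i, 'E_P[phi i \o X i] <= c%:E)%E ->
  ('E_P[fun w => (\prod_i phi i (X i w))%R] <= (c ^+ N)%:E)%E.
Proof.
move=> phi0 mphi phic; rewrite expectation_prod_independent//; last first.
  by move=> i; rewrite (le_lt_trans (phic i))// ltry.
have -> : c ^+ N = \prod_(i < N) c by rewrite prodr_const card_ord.
rewrite -prodEFin; elim: (index_enum _) => [|i s ih]; rewrite ?big_nil//.
rewrite !big_cons; apply: lee_pmul => //.
- by apply: expectation_ge0 => w /=.
- by apply: prode_ge0 => j _; apply: expectation_ge0 => w /=.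
Qed.

Lemma csq_mgf f g (l : R) : G f -> G g -> 0 <= l ->
  l * bern_scale f g <= 2^-1 ->
  ('E_P[fun w => (expR (l * csq f g w))%R] <=
    (expR (C1 * N%:R * l ^+ 2 * bern_scale f g ^+ 2))%:E)%E.
Proof.
move=> Gf Gg l0 lK; have [K0|K0] := eqVneq (bern_scale f g) 0.
  rewrite K0 expr0n/= mulr0 expR0 (bern_scale_eq0 Gf Gg K0).
  rewrite (_ : (fun w => _) = cst 1) ?expectation_cst//.
  by apply/funext => w; rewrite csqxx mulr0 expR0.
have Kp : 0 < bern_scale f g by rewrite lt_def K0 bern_scale_ge0.
pose phi i x :=
  expR (l * (f x ^+ 2 - g x ^+ 2 - (mean_sq f i - mean_sq g i))).
rewrite (_ : (fun w => _) = fun w => \prod_i phi i (X i w)); last first.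
  by apply/funext => w; rewrite /csq mulr_sumr expR_sum.
rewrite (_ : expR _ = expR (C1 * l ^+ 2 * bern_scale f g ^+ 2) ^+ N); last first.
  by rewrite -expRM_natl; congr expR; ring.
apply: expectation_prod_le.
- by move=> i x; exact: expR_ge0.
- move=> i; apply: measurableT_comp => //; apply: measurable_funM => //.
  by apply: measurable_funB => //; apply: measurable_funB;
    apply: measurable_funX; exact: mG.
- move=> i; apply: centered_mgf => //.
  + exact: mfX2.
  + exact: mfX2.
  + by move=> w; exact: sqr_ge0.
  + by move=> w; exact: sqr_ge0.
  + exact: sq_expectation.
  + exact: sq_expectation.
  + exact: sq_diff_exp_moment.
Qed.

Lemma dsq_exp_moment f g : G f -> G g ->
  ('E_P[fun w => (expR (dsq f g w / d f g ^+ 2 / 2))%R] <= (C0 ^+ N)%:E)%E.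
Proof.
move=> Gf Gg; pose phi (i : 'I_N) x := expR ((f x - g x) ^+ 2 / d f g ^+ 2 / 2).
rewrite (_ : (fun w => _) = fun w => \prod_i phi i (X i w)); last first.
  by apply/funext => w; rewrite /dsq !mulr_suml expR_sum.
apply: expectation_prod_le.
- by move=> i x; exact: expR_ge0.
- move=> i; apply: measurableT_comp => //; apply: measurable_funM => //.
  apply: measurable_funM => //; apply: measurable_funX.
  by apply: measurable_funB; exact: mG.
- by move=> i; exact: diff_exp_moment.
Qed.

Lemma measurable_csq f g : G f -> G g -> measurable_fun setT (csq f g).
Proof.
move=> Gf Gg; apply: measurable_sum => i; apply: measurable_funB => //.
by apply: measurable_funB; exact: mfX2.
Qed.

Lemma measurable_dsq f g : G f -> G g -> measurable_fun setT (dsq f g).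
Proof.
move=> Gf Gg; apply: measurable_sum => i; apply: measurable_funX.
by apply: measurable_funB; exact: mfX.
Qed.

(* The exponent of Bernstein's inequality. *)
Definition bern f g (w : Omega) : R :=
  let x := Num.max (csq f g w / bern_scale f g) 0 in
  Num.min (x ^+ 2 / (4 * C1 * N%:R)) (x / 4).

Let C1N_gt0 : 0 < C1 * N%:R.
Proof. by rewrite mulr_gt0 ?ltr0n// mulr_gt0. Qed.

Lemma bern_ge0 f g w : 0 <= bern f g w.
Proof.
rewrite /bern le_min; apply/andP; split; apply: divr_ge0 => //.
- exact: sqr_ge0.
- by rewrite -mulrA mulr_ge0// ltW.
- by rewrite le_max lexx orbT.
Qed.

Lemma measurable_bern f g : G f -> G g -> measurable_fun setT (bern f g).
Proof.
move=> Gf Gg.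
have mx : measurable_fun setT (fun w => Num.max (csq f g w / bern_scale f g) 0).
  apply: measurable_maxr => //; apply: measurable_funM => //.
  exact: measurable_csq.
apply: measurable_minr; apply: measurable_funM => //.
exact: measurable_funX.
Qed.

(** Chernoff's bound at the parameter [l / K], [K = bern_scale f g]. The factors 4 in [bern] are
    such that [bern >= t] gives [l U(f,g) / K >= 2 t] in either case of the minimum defining [l],
    while the exponential moment costs at most [e^t]. *)
Lemma bern_tail f g (t : R) : G f -> G g -> 0 < t ->
  (P [set w | (t <= bern f g w)%R] <= (expR (- t))%:E)%E.
Proof.
move=> Gf Gg t0; have [K0|K0] := eqVneq (bern_scale f g) 0.
  rewrite (_ : [set w | _] = set0) ?measure0 ?lee_fin ?expR_ge0//.
  apply/seteqP; split => w //=; rewrite /bern K0 invr0 mulr0 maxxx.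
  by rewrite expr0n/= !mul0r minxx leNgt t0.
have Kp : 0 < bern_scale f g by rewrite lt_def K0 bern_scale_ge0.
pose l : R := Num.min (Num.sqrt (t / (C1 * N%:R))) 2^-1.
have l0 : 0 <= l by rewrite le_min sqrtr_ge0 invr_ge0/=.
have l2 : l <= 2^-1 by rewrite ge_min lexx orbT.
have lt : C1 * N%:R * l ^+ 2 <= t.
  rewrite mulrC -ler_pdivlMr// -[leRHS]sqr_sqrtr; last first.
    by rewrite divr_ge0// ltW.
  by rewrite ler_sqr ?nnegrE ?sqrtr_ge0// ge_min lexx.
have ml : measurable_fun setT (fun w => expR (l / bern_scale f g * csq f g w)).
  apply: measurableT_comp => //; apply: measurable_funM => //.
  exact: measurable_csq.
apply: (@le_trans _ _ (P [set w |
    (expR (2 * t) <= expR (l / bern_scale f g * csq f g w))%R])).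
  apply: le_measure; rewrite ?inE.
  - by apply/mem_set/measurable_superlevel; exact: measurable_bern.
  - by apply/mem_set; exact: measurable_superlevel.
  - move=> w /=; rewrite /bern.
    set y := csq f g w / bern_scale f g; rewrite le_min => /andP[h1 h2].
    rewrite ler_expR.
    have -> : l / bern_scale f g * csq f g w = l * y by rewrite /y; ring.
    have y0 : 0 < y.
      have : 0 < Num.max y 0 by move: h2; rewrite ler_pdivlMr//; nra.
      by rewrite lt_max ltxx orbF.
    move: h1 h2; rewrite (max_idPl (ltW y0)) => h1 h2.
    rewrite /l; case: (leP (Num.sqrt _) 2^-1) => _; last by lra.
    rewrite -ler_sqr ?nnegrE; last 2 first.
    + by rewrite mulr_ge0// ltW.
    + by rewrite mulr_ge0 ?sqrtr_ge0// ltW.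
    rewrite exprMn [leRHS]exprMn sqr_sqrtr; last by rewrite divr_ge0// ltW.
    have -> : t / (C1 * N%:R) * y ^+ 2 = t * 4 * (y ^+ 2 / (4 * C1 * N%:R)).
      by field; rewrite pnatr_eq0 -lt0n N_gt0 gt_eqF.
    rewrite (_ : 2 ^+ 2 * t ^+ 2 = t * 4 * t); last by ring.
    by apply: ler_wpM2l => //; rewrite mulr_ge0// ltW.
apply: (le_trans (ge0_markov P ml (fun w => expR_ge0 _) (expR_gt0 _))).
rewrite lee_pdivrMl ?expR_gt0// -EFinM -expRD.
apply: (le_trans (csq_mgf Gf Gg _ _)).
- by rewrite divr_ge0// ltW.
- by rewrite divfK.
rewrite lee_fin ler_expR.
have -> : C1 * N%:R * (l / bern_scale f g) ^+ 2 * bern_scale f g ^+ 2 =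
    C1 * N%:R * l ^+ 2 by field.
by move: lt; lra.
Qed.

Lemma bern_exp_moment f g : G f -> G g ->
  ('E_P[fun w => (expR (bern f g w / 2))%R] <= C0%:E)%E.
Proof.
move=> Gf Gg; apply: expectation_exp_half.
- exact: measurable_bern.
- exact: bern_ge0.
- move=> t t0; rewrite (le_trans (bern_tail Gf Gg t0))// lee_fin.
  by have := expR_gt0 (- t); lra.
Qed.

(** One of the two terms of the minimum in [bern] is at most [t], and the sum of the two inverse
    functions covers both cases. *)
Lemma bern_le_csq f g w (t : R) : G f -> G g -> bern f g w <= t ->
  csq f g w <= bern_scale f g * (Num.sqrt (4 * C1 * N%:R * t) + 4 * t).
Proof.
move=> Gf Gg bt; have [K0|K0] := eqVneq (bern_scale f g) 0.
  by rewrite K0 mul0r (bern_scale_eq0 Gf Gg K0) csqxx.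
have t0 := le_trans (bern_ge0 f g w) bt.
have Kp : 0 < bern_scale f g by rewrite lt_def K0 bern_scale_ge0.
rewrite mulrC -ler_pdivrMr//; move: bt; rewrite /bern.
set y := csq f g w / bern_scale f g.
have [y0|y0] := leP y 0.
  by move=> _; rewrite (le_trans y0)// addr_ge0 ?sqrtr_ge0 ?mulr_ge0.
rewrite ge_min => /orP[]; rewrite ler_pdivrMr//.
- move=> h; apply: (@le_trans _ _ (Num.sqrt (4 * C1 * N%:R * t))); last first.
    by rewrite lerDl mulr_ge0.
  rewrite -ler_sqr ?nnegrE ?sqrtr_ge0 ?(ltW y0)// sqr_sqrtr.
    by rewrite mulrC.
  by rewrite mulr_ge0// -mulrA mulr_ge0// ltW.
- by rewrite -mulrA mulr_gt0.
- by move=> h; rewrite mulrC in h; rewrite (le_trans h)// lerDr sqrtr_ge0.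
Qed.

End subgaussian_process.

(** * A single variable controlling all levels *)

Section weighted_supremum.
Context {R : realType} {dO : measure_display} {Omega : measurableType dO}
  (P : probability Omega R).

(** [Z] is half of 1 plus the sum of [2^-(n+1) E_n]; the added 1 keeps [Z], hence [log2 (1 + Z)],
    away from 0. The series may diverge on a null event, where [fine] makes it 0. *)
Lemma weighted_supremum (E : nat -> Omega -> R) :
  (forall n, measurable_fun setT (E n)) -> (forall n w, 0 <= E n w) ->
  (forall n, 'E_P[E n] <= 1)%E ->
  exists Z : Omega -> R, [/\ measurable_fun setT Z, forall w, 2^-1 <= Z w,
    ('E_P[Z] <= 1)%E &
    {ae P, forall w n, E n w <= 2 ^+ n.+2 * Z w}].
Proof.
move=> mE E0 EE.
pose g n w : R := (2 ^+ n.+1)^-1 * E n w.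
have g0 n w : 0 <= g n w by rewrite mulr_ge0 ?invr_ge0 ?exprn_ge0.
have mg n : measurable_fun setT (g n) by exact: measurable_funM.
pose S w : \bar R := (\sum_(0 <= n <oo) (g n w)%:E)%E.
have S0 w : (0 <= S w)%E by apply: nneseries_ge0 => n _ _; rewrite lee_fin.
have mS : measurable_fun setT S.
  apply: ge0_emeasurable_sum => [n w _ _|n _]; first by rewrite lee_fin.
  exact/measurable_EFinP.
have intS : (\int[P]_w S w <= 1)%E.
  rewrite integral_nneseries//; last 2 first.
  - by move=> n; exact/measurable_EFinP.
  - by move=> n w _; rewrite lee_fin.
  have term n : (\int[P]_w (g n w)%:E <= ((2 ^+ n.+1)^-1)%:E)%E.
    have nn : 0 <= (2 ^+ n.+1)^-1 :> R by rewrite invr_ge0 exprn_ge0.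
    have := ge0_expectationZl P (mE n) (E0 n) nn; rewrite unlock => ->.
    rewrite -[leRHS]mule1 lee_wpmul2l ?lee_fin ?invr_ge0 ?exprn_ge0//.
    by have := EE n; rewrite unlock.
  apply: (@le_trans _ _ (\sum_(0 <= n <oo) ((2 ^+ n.+1)^-1 : R)%:E)%E).
    apply: lee_nneseries => [n _ _|n _ //].
    by apply: integral_ge0 => w _; rewrite lee_fin.
  apply: lime_le.
    by apply: is_cvg_nneseries => n _ _; rewrite lee_fin invr_ge0 exprn_ge0.
  apply: nearW => n; rewrite sumEFin lee_fin.
  have -> : \sum_(0 <= k < n) (2 ^+ k.+1)^-1 = 1 - (2 ^+ n)^-1 :> R.
    elim: n => [|n ih]; first by rewrite big_geq// expr0 invr1 subrr.
    rewrite big_nat_recr//= ih exprS; field.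
    by rewrite expf_neq0.
  by rewrite gerBl invr_ge0 exprn_ge0.
have aeS : {ae P, forall w, S w \is a fin_num}.
  have iS : P.-integrable setT S.
    apply/integrableP; split => //.
    under eq_integral do rewrite gee0_abs//.
    by rewrite (le_lt_trans intS)// ltry.
  apply: filterS (integrable_ae measurableT iS) => w; exact.
have mfS : measurable_fun setT (fine \o S) by exact: measurableT_comp.
have fS0 w : 0 <= fine (S w) by rewrite fine_ge0.
exists (fun w => 2^-1 * (1 + fine (S w))); split.
- by apply: measurable_funM => //; exact: measurable_funD.
- by move=> w; rewrite ler_peMr// lerDl.
- rewrite ge0_expectationZl//; last 2 first.
  + exact: measurable_funD.
  + by move=> w; rewrite addr_ge0.
  rewrite ge0_expectationD// expectation_cst.
  have : ('E_P[fine \o S] <= 1)%E.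
    rewrite unlock; apply: le_trans intS; apply: ge0_le_integral => //.
    + by move=> w _; rewrite lee_fin fS0.
    + exact/measurable_EFinP.
    + move=> w _ /=; case: (S w) (S0 w) => [x||]//= _; exact: leey.
  move=> h; rewrite lee_pdivrMl//.
  by rewrite mule1 (_ : 2%:E = 1 + 1)%E ?leeD2l// -EFinD.
- apply: filterS aeS => w Sfin n.
  have : ((g n w)%:E <= S w)%E.
    apply: (le_trans _ (nneseries_lim_ge n.+1 _)); last first.
      by move=> k _ _; rewrite lee_fin.
    rewrite big_nat_recr//= -[leLHS]add0e leeD//.
    by apply: sume_ge0 => k _; rewrite lee_fin.
  rewrite -(fineK Sfin) lee_fin /g ler_pdivrMl ?exprn_gt0// => h.
  apply: (le_trans h).
  have -> : 2 ^+ n.+2 * (2^-1 * (1 + fine (S w))) =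
      2 ^+ n.+1 * (1 + fine (S w)).
    by rewrite (exprS _ n.+1); field.
  by apply: ler_wpM2l; rewrite ?exprn_ge0// lerDr.
Qed.

Lemma expectation_average (I : finType) (x : I -> Omega -> R) (c : R) :
  0 < c -> (0 < #|I|)%N -> (forall i, measurable_fun setT (x i)) ->
  (forall i w, 0 <= x i w) -> (forall i, 'E_P[x i] <= c%:E)%E ->
  ('E_P[fun w => ((#|I|%:R * c)^-1 * \sum_i x i w)%R] <= 1)%E.
Proof.
move=> c0 I0 mx x0 xc.
have Ic0 : 0 < #|I|%:R * c by rewrite mulr_gt0// ltr0n.
rewrite ge0_expectationZl//; last 3 first.
- exact: measurable_sum.
- by move=> w; exact: sumr_ge0.
- by rewrite invr_ge0 ltW.
rewrite lee_pdivrMl// mule1 ge0_expectation_sum//.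
apply: (@le_trans _ _ (\sum_(i : I) c%:E)%E); first exact: lee_sum.
by rewrite sumEFin sumr_const lee_fin mulr_natl.
Qed.

Lemma average_ge (I : finType) (x : I -> R) (c : R) (i : I) :
  0 < c -> (forall i, 0 <= x i) ->
  x i <= #|I|%:R * c * ((#|I|%:R * c)^-1 * \sum_j x j).
Proof.
move=> c0 x0; have I0 : (0 < #|I|)%N by apply/card_gt0P; exists i.
rewrite mulVKf; last by rewrite gt_eqF// mulr_gt0// ltr0n.
by rewrite (bigD1 i)//= lerDl sumr_ge0.
Qed.

End weighted_supremum.

Section chaining_variable.
Context {R : realType} {dO dX : measure_display} {Omega : measurableType dO}
  {TX : measurableType dX} (P : probability Omega R) (N : nat)
  (X : 'I_N -> {RV P >-> TX}).
Context (G : set (TX -> R)) (d : (TX -> R) -> (TX -> R) -> R) (alpha : R).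
Context (N_gt0 : (0 < N)%N) (indep : mutually_independent P X)
  (mG : forall f, G f -> measurable_fun setT f) (distG : is_distance G d)
  (tailG : forall f g, G f -> G g -> forall (i : 'I_N) (u : R), 0 < u ->
     (P [set w | (u <= `|f (X i w) - g (X i w)|)%R] <=
       (2 * gauss_tail u (d f g))%:E)%E)
  (G0 : G (cst 0)) (dG_le : forall f, G f -> d f (cst 0) <= alpha).

Local Notation C0 := (exp_moment_bound : R).
Local Notation C1 := (16 * exp_moment_bound : R).

Let C0_ge1 : 1 <= C0 := exp_moment_bound_ge1.
Let C0_gt0 : 0 < C0 := lt_le_trans ltr01 C0_ge1.

(** One more than the cardinality allowed to the n-th net, which leaves room for the zero function;
    at [n = 0] it is 2. *)
Definition net_size n : nat := 2 ^ (2 ^ (2 * n)).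

Lemma net_size_gt0 n : (0 < net_size n)%N.
Proof. by rewrite expn_gt0. Qed.

(** Chosen for [4 + n + 2 * 4^n <= 8 * 4^n] in the logarithm of the weights; [ln C0] pays for the
    normalising moments. *)
Definition log_const : R := 8 + ln C0.

Let lnC0_ge0 : 0 <= ln C0. Proof. exact: ln_ge0. Qed.

Lemma log_const_ge0 : 0 <= log_const.
Proof. by rewrite addr_ge0. Qed.

Definition bern_const : R := 8 * (Num.sqrt (8 * C1 * log_const) + 8 * log_const).

Lemma bern_const_ge0 : 0 <= bern_const.
Proof.
by rewrite mulr_ge0// addr_ge0 ?sqrtr_ge0// mulr_ge0 ?log_const_ge0.
Qed.

Definition dsq_const : R := 2 * log_const.

Lemma dsq_const_ge0 : 0 <= dsq_const.
Proof. by rewrite mulr_ge0 ?log_const_ge0. Qed.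

Let ln2_le1 : ln 2 <= 1 :> R.
Proof. by have := @le_ln1Dx R 1 ltac:(lra). Qed.

Let ln2_gt0 : 0 < ln 2 :> R.
Proof. by rewrite ln_gt0// ltr1n. Qed.

(** Weights cost only their logarithm: 3 counts the families averaged in [chaining_variable], [r]
    the members of a family, [c] bounds their moments, and [2^(n+2)] comes from
    [weighted_supremum]. *)
Let log_size (y r c z : R) (n : nat) : 0 < r -> 0 < c -> 0 < z ->
  expR y <= 3 * (r * c * (2 ^+ n.+2 * z)) ->
  y <= 4 + n%:R + ln r + ln c + log2 (1 + z).
Proof.
move=> r0 c0 z0 h.
have p0 : 0 < 2 ^+ n.+2 :> R by rewrite exprn_gt0.
have rc0 : 0 < r * c by exact: mulr_gt0.
have pz0 : 0 < 2 ^+ n.+2 * z by exact: mulr_gt0.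
have rcpz0 : 0 < r * c * (2 ^+ n.+2 * z) by exact: mulr_gt0.
have : y <= ln (3 * (r * c * (2 ^+ n.+2 * z))).
  rewrite -[leLHS](expRK y) ler_ln ?posrE ?expR_gt0//.
  exact: mulr_gt0.
have lnm (u v : R) : 0 < u -> 0 < v -> ln (u * v) = ln u + ln v.
  by move=> u0 v0; rewrite lnM.
rewrite (lnm 3)// (lnm (r * c))// (lnm r)// (lnm (2 ^+ n.+2))// lnXn//.
have h3 : ln 3 <= 2 :> R by have := @le_ln1Dx R 2 ltac:(lra).
have hn : ln 2 *+ n.+2 <= n%:R + 2 :> R.
  by rewrite -(mulr_natl (ln 2)) -[n.+2]addn2 natrD ler_piMr// addr_ge0.
have hz : ln z <= log2 (1 + z).
  have h1 : ln z <= ln (1 + z) by rewrite ler_ln ?posrE ?addr_gt0// lerDr.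
  apply: (le_trans h1); rewrite /log2 ler_pdivlMr// ler_piMr//.
  by rewrite ln_ge0// lerDl ltW.
by lra.
Qed.

(** [e n] will list the n-th net and the zero function, [a j n] and [b j n] the [j]-th function of a
    separating sequence and its nearest point in the n-th net. With [j <= n] only [n + 1] pairs
    enter at level [n], at a logarithmic cost at most [n], yet each [j] is covered from some level
    on. *)
Lemma chaining_variable (e a b : nat -> nat -> TX -> R) :
  (forall n i, G (e n i)) -> (forall j n, G (a j n)) -> (forall j n, G (b j n)) ->
  exists Z : Omega -> R, [/\ measurable_fun setT Z, forall w, 2^-1 <= Z w,
    ('E_P[Z] <= 1)%E &
    {ae P, forall w,
      (forall n (i j : nat), (i < net_size n)%N -> (j < net_size n)%N ->
        let t := 4 ^+ n + log2 (1 + Z w) in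
        csq X (e n i) (e n j) w <= bern_const * alpha * d (e n i) (e n j) *
          (Num.sqrt N%:R * Num.sqrt t + t) /\
        dsq X (e n i) (e n j) w <=
          dsq_const * d (e n i) (e n j) ^+ 2 * (N%:R + t)) /\
      (forall (j n : nat), (j <= n)%N ->
        dsq X (a j n) (b j n) w <=
          dsq_const * d (a j n) (b j n) ^+ 2 *
            (N%:R + (n%:R + log2 (1 + Z w))))}].
Proof.
move=> Ge Ga Gb.
pose x1 n (ij : 'I_(net_size n) * 'I_(net_size n)) w :=
  expR (bern X d alpha (e n ij.1) (e n ij.2) w / 2).
pose q f g w := expR (dsq X f g w / d f g ^+ 2 / 2).
pose x2 n (ij : 'I_(net_size n) * 'I_(net_size n)) := q (e n ij.1) (e n ij.2).
pose x3 n (j : 'I_n.+1) := q (a j n) (b j n).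
pose av (I : finType) (x : I -> Omega -> R) (c : R) w :=
  (#|I|%:R * c)^-1 * \sum_i x i w.
have mq f g : G f -> G g -> measurable_fun setT (q f g).
  move=> Gf Gg; apply: measurableT_comp => //; apply: measurable_funM => //.
  by apply: measurable_funM => //; exact: (measurable_dsq X mG).
have m1 n ij : measurable_fun setT (x1 n ij).
  apply: measurableT_comp => //; apply: measurable_funM => //.
  exact: (measurable_bern X d alpha mG).
have mav (I : finType) (x : I -> Omega -> R) c :
    (forall i, measurable_fun setT (x i)) -> measurable_fun setT (av I x c).
  by move=> mx; apply: measurable_funM => //; exact: measurable_sum.
have av0 (I : finType) (x : I -> Omega -> R) c w : 0 < c ->
    (forall i w, 0 <= x i w) -> 0 <= av I x c w.
  move=> c0 x0; rewrite mulr_ge0 ?sumr_ge0// invr_ge0 mulr_ge0//.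
  exact: ltW.
have CN0 : 0 < C0 ^+ N by rewrite exprn_gt0.
have Eq f g : G f -> G g -> ('E_P[q f g] <= (C0 ^+ N)%:E)%E.
  exact: (dsq_exp_moment indep mG distG tailG).
have cardII n : (0 < #|{: 'I_(net_size n) * 'I_(net_size n)}|)%N.
  by rewrite card_prod card_ord muln_gt0 net_size_gt0.
pose E n w := 3^-1 * (av _ (x1 n) C0 w + av _ (x2 n) (C0 ^+ N) w +
  av _ (x3 n) (C0 ^+ N) w).
have a1 n w : 0 <= av _ (x1 n) C0 w by apply: av0 => // *; exact: expR_ge0.
have a2 n w : 0 <= av _ (x2 n) (C0 ^+ N) w.
  by apply: av0 => // *; exact: expR_ge0.
have a3 n w : 0 <= av _ (x3 n) (C0 ^+ N) w.
  by apply: av0 => // *; exact: expR_ge0.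
have ma1 n : measurable_fun setT (av _ (x1 n) C0) by exact: mav.
have ma2 n : measurable_fun setT (av _ (x2 n) (C0 ^+ N)).
  by apply: mav => i; exact: mq.
have ma3 n : measurable_fun setT (av _ (x3 n) (C0 ^+ N)).
  by apply: mav => i; exact: mq.
have ma12 n : measurable_fun setT
    (fun w => av _ (x1 n) C0 w + av _ (x2 n) (C0 ^+ N) w).
  exact: measurable_funD.
have E1 n : ('E_P[E n] <= 1)%E.
  rewrite ge0_expectationZl//; last 2 first.
  - exact: measurable_funD.
  - by move=> w; rewrite !addr_ge0.
  rewrite ge0_expectationD//; last by move=> w; rewrite addr_ge0.
  rewrite ge0_expectationD// lee_pdivrMl// mule1.
  rewrite (_ : 3%:E = 1 + 1 + 1)%E; last by rewrite -!EFinD; congr EFin; lra.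
  apply: leeD; first apply: leeD.
  - apply: expectation_average => // [i w|i]; first exact: expR_ge0.
    exact: (bern_exp_moment N_gt0 indep mG distG tailG G0 dG_le).
  - apply: expectation_average => // [i|i w|i]; first exact: mq.
      exact: expR_ge0.
    exact: Eq.
  - apply: expectation_average => // [|i|i w|i]; first by rewrite card_ord.
    + exact: mq.
    + exact: expR_ge0.
    + exact: Eq.
have [Z [mZ Z2 EZ aeZ]] : exists Z : Omega -> R,
    [/\ measurable_fun setT Z, forall w, 2^-1 <= Z w, ('E_P[Z] <= 1)%E &
    {ae P, forall w n, E n w <= 2 ^+ n.+2 * Z w}].
  apply: weighted_supremum => // n.
  - by apply: measurable_funM => //; exact: measurable_funD.
  - by move=> w; rewrite mulr_ge0// !addr_ge0.
exists Z; split => //; apply: filterS aeZ => w Ew.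
have Z0 : 0 < Z w by apply: lt_le_trans (Z2 w).
set s := log2 (1 + Z w).
have s0 : 0 <= s by rewrite divr_ge0// ?ln_ge0// ?lerDl ltW.
have N1 : 1 <= N%:R :> R by rewrite ler1n.
have lnCN : ln (C0 ^+ N) = N%:R * ln C0 by rewrite lnXn// mulr_natl.
have n4 n : n%:R <= 4 ^+ n :> R.
  by rewrite -natrX ler_nat ltnW// ltn_expl.
have ln_size n : ln (#|{: 'I_(net_size n) * 'I_(net_size n)}|%:R) <=
    2 * 4 ^+ n :> R.
  rewrite card_prod card_ord natrM lnM ?posrE ?ltr0n ?net_size_gt0//.
  rewrite /net_size natrX lnXn// expnM.
  have : ln 2 *+ (2 ^ 2) ^ n <= 4 ^+ n :> R.
    by rewrite -(mulr_natl (ln 2)) natrX ler_piMr ?exprn_ge0.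
  by lra.
have scale3 (u v z : R) : 0 <= u -> v <= 3 * z -> u * v <= 3 * (u * z).
  by move=> u0 vz; rewrite mulrCA; exact: ler_wpM2l.
have le1 n ij : x1 n ij w <= 3 *
    (#|{: 'I_(net_size n) * 'I_(net_size n)}|%:R * C0 * (2 ^+ n.+2 * Z w)).
  have := average_ge (x := x1 n ^~ w) ij C0_gt0 (fun=> expR_ge0 _).
  rewrite -/(av _ (x1 n) C0 w) => /le_trans; apply.
  apply: scale3; first by rewrite mulr_ge0// ltW.
  by have := Ew n; rewrite /E; have := a2 n w; have := a3 n w; lra.
have le2 n ij : x2 n ij w <= 3 * (#|{: 'I_(net_size n) * 'I_(net_size n)}|%:R *
    C0 ^+ N * (2 ^+ n.+2 * Z w)).
  have := average_ge (x := x2 n ^~ w) ij CN0 (fun=> expR_ge0 _).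
  rewrite -/(av _ (x2 n) _ w) => /le_trans; apply.
  apply: scale3; first by rewrite mulr_ge0// ltW.
  by have := Ew n; rewrite /E; have := a1 n w; have := a3 n w; lra.
have le3 n j : x3 n j w <= 3 * (#|'I_n.+1|%:R * C0 ^+ N * (2 ^+ n.+2 * Z w)).
  have := average_ge (x := x3 n ^~ w) j CN0 (fun=> expR_ge0 _).
  rewrite -/(av _ (x3 n) _ w) => /le_trans; apply.
  apply: scale3; first by rewrite mulr_ge0// ltW.
  by have := Ew n; rewrite /E; have := a1 n w; have := a2 n w; lra.
have dsq_le f g (t : R) : G f -> G g -> 0 <= t ->
    dsq X f g w / d f g ^+ 2 / 2 <= log_const * t ->
    dsq X f g w <= dsq_const * d f g ^+ 2 * t.
  move=> Gf Gg t0; have [d0 _|d0] := eqVneq (d f g) 0.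
    rewrite (dist_eq0 distG Gf Gg d0) /dsq big1.
      by rewrite mulr_ge0// mulr_ge0 ?sqr_ge0 ?dsq_const_ge0.
    by move=> i _; rewrite subrr expr0n.
  have dp : 0 < d f g ^+ 2 by rewrite lt_def sqrf_eq0 d0 sqr_ge0.
  rewrite ler_pdivrMr// ler_pdivrMr// => h; apply: (le_trans h).
  rewrite le_eqVlt; apply/orP; left; apply/eqP; rewrite /dsq_const; ring.
have C1N0 : 0 < C1 * N%:R by rewrite mulr_gt0 ?ltr0n// mulr_gt0.
have lC0N : 0 <= ln C0 * N%:R by rewrite mulr_ge0.
split=> [n i j im jm|j n jn].
  set t := 4 ^+ n + s.
  pose ij := (Ordinal im, Ordinal jm).
  have p4 : 1 <= 4 ^+ n :> R by rewrite exprn_ege1// ler1n.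
  have t0 : 0 <= t by rewrite addr_ge0// (le_trans ler01).
  have c1 : 0 < #|{: 'I_(net_size n) * 'I_(net_size n)}|%:R :> R.
    by rewrite ltr0n.
  have := ln_size n; have := n4 n => hn hsz.
  split.
  - have := log_size c1 C0_gt0 Z0 (le1 n ij); rewrite -/s => hy.
    have hb : bern X d alpha (e n i) (e n j) w <= 2 * log_const * t.
      rewrite /log_const /t; move: hy; rewrite /=.
      have := mulr_ge0 lnC0_ge0 s0.
      have : ln C0 <= ln C0 * 4 ^+ n by rewrite ler_peMr.
      by lra.
    have := bern_le_csq N_gt0 distG G0 dG_le (Ge n i) (Ge n j) hb.
    move=> /le_trans; apply.
    have -> : 4 * C1 * N%:R * (2 * log_const * t) =
        (8 * C1 * log_const) * (N%:R * t) by ring.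
    rewrite sqrtrM; last first.
      by rewrite mulr_ge0 ?log_const_ge0// mulr_ge0// mulr_ge0// ltW.
    rewrite (sqrtrM t)// /bern_scale /bern_const.
    set D := d _ _; set r8 := Num.sqrt (8 * C1 * log_const).
    set A := Num.sqrt N%:R * Num.sqrt t.
    have A0 : 0 <= A by rewrite mulr_ge0 ?sqrtr_ge0.
    have r0 : 0 <= r8 by rewrite sqrtr_ge0.
    have -> : 8 * alpha * D * (r8 * A + 4 * (2 * log_const * t)) =
        alpha * D * (8 * (r8 * A + 8 * log_const * t)) by ring.
    have -> : 8 * (r8 + 8 * log_const) * alpha * D * (A + t) =
        alpha * D * (8 * ((r8 + 8 * log_const) * (A + t))) by ring.
    apply: ler_wpM2l.
      by rewrite mulr_ge0 ?(dist_alpha_ge0 distG G0 dG_le)// (dist_ge0 distG).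
    apply: ler_wpM2l => //.
    have := mulr_ge0 r0 t0; have := mulr_ge0 log_const_ge0 A0; lra.
  - apply: dsq_le => //; first by rewrite addr_ge0.
    have := log_size c1 CN0 Z0 (le2 n ij); rewrite -/s lnCN => hy.
    rewrite /log_const /t; move: hy; rewrite /x2 /q /=.
    have := mulr_ge0 lnC0_ge0 s0.
    have : 0 <= ln C0 * 4 ^+ n by rewrite mulr_ge0// (le_trans ler01).
    by lra.
apply: dsq_le => //; first by rewrite !addr_ge0.
have jn' : (j < n.+1)%N by [].
have c1 : 0 < #|'I_n.+1|%:R :> R by rewrite card_ord.
have := log_size c1 CN0 Z0 (le3 n (Ordinal jn')); rewrite -/s lnCN card_ord.
have hn1 : ln n.+1%:R <= n%:R :> R.
  by rewrite -natr1 addrC; apply: le_ln1Dx; rewrite (lt_le_trans _ (ler0n _ _)).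
rewrite /log_const /x3 /q /=.
have := mulr_ge0 lnC0_ge0 s0.
have : 0 <= ln C0 * n%:R by rewrite mulr_ge0.
have n0 : 0 <= n%:R :> R by [].
by lra.
Qed.

End chaining_variable.

(** * Pathwise chaining *)

Section chain_bound.
Context {R : realType} (N : nat).

Implicit Types x y : 'I_N -> R.

(** Cauchy-Schwarz, from [x y <= (B/A) x^2 / 2 + (A/B) y^2 / 2] termwise; if a bound is 0, that
    vector vanishes. *)
Lemma sum_mul_le x y (A B : R) : 0 <= A -> 0 <= B ->
  \sum_i x i ^+ 2 <= A ^+ 2 -> \sum_i y i ^+ 2 <= B ^+ 2 ->
  \sum_i x i * y i <= A * B.
Proof.
have z u (C : R) : C = 0 -> \sum_i u i ^+ 2 <= C ^+ 2 ->
    forall i : 'I_N, u i = 0 :> R.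
  move=> ->; rewrite expr0n/= => u0 i; apply/eqP; rewrite -sqrf_eq0.
  rewrite eq_le sqr_ge0 andbT; apply: le_trans u0.
  by rewrite (bigD1 i)//= lerDl sumr_ge0// => j _; exact: sqr_ge0.
move=> A0 B0 xA yB.
have [A00|An0] := eqVneq A 0.
  by rewrite A00 mul0r big1// => i _; rewrite (z _ _ A00 xA) mul0r.
have [B00|Bn0] := eqVneq B 0.
  by rewrite B00 mulr0 big1// => i _; rewrite (z _ _ B00 yB) mulr0.
have Ap : 0 < A by rewrite lt_def An0.
have Bp : 0 < B by rewrite lt_def Bn0.
apply: (@le_trans _ _
    (\sum_i (B / A / 2 * x i ^+ 2 + A / B / 2 * y i ^+ 2))).
  apply: ler_sum => i _.
  have : 0 <= (B * x i - A * y i) ^+ 2 / (A * B * 2).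
    by rewrite divr_ge0 ?sqr_ge0// !mulr_ge0.
  have -> : (B * x i - A * y i) ^+ 2 / (A * B * 2) =
      B / A / 2 * x i ^+ 2 + A / B / 2 * y i ^+ 2 - x i * y i.
    by field; rewrite An0 Bn0.
  by rewrite subr_ge0.
rewrite big_split/= -!mulr_sumr.
have -> : A * B = B / A / 2 * A ^+ 2 + A / B / 2 * B ^+ 2.
  by field; rewrite An0 Bn0.
by apply: lerD; apply: ler_wpM2l => //; rewrite !divr_ge0.
Qed.

(** Minkowski's inequality, with bounds on squares in place of norms. *)
Lemma sum_sqrD_le x y (A B : R) : 0 <= A -> 0 <= B ->
  \sum_i x i ^+ 2 <= A ^+ 2 -> \sum_i y i ^+ 2 <= B ^+ 2 ->
  \sum_i (x i + y i) ^+ 2 <= (A + B) ^+ 2.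
Proof.
move=> A0 B0 xA yB; have xy := sum_mul_le A0 B0 xA yB.
rewrite (eq_bigr (fun i => x i ^+ 2 + 2 * (x i * y i) + y i ^+ 2)); last first.
  by move=> i _; ring.
rewrite 2!big_split/= -mulr_sumr.
have -> : (A + B) ^+ 2 = A ^+ 2 + 2 * (A * B) + B ^+ 2 by ring.
by apply: lerD => //; apply: lerD => //; exact: ler_wpM2l.
Qed.

Lemma sum_sqr_chain_le (p : nat -> 'I_N -> R) (c : nat -> R) (b n : nat) :
  (forall k, (b <= k)%N -> 0 <= c k) ->
  (forall k, (b <= k)%N -> \sum_i (p k.+1 i - p k i) ^+ 2 <= c k ^+ 2) ->
  \sum_i (p (b + n)%N i - p b i) ^+ 2 <= (\sum_(b <= k < b + n) c k) ^+ 2.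
Proof.
move=> c0 pc; elim: n => [|n ih].
  rewrite addn0 big_geq// expr0n big1// => i _.
  by rewrite subrr expr0n.
rewrite addnS big_nat_recr ?leq_addr//=.
rewrite (eq_bigr (fun i => ((p (b + n)%N i - p b i) +
    (p (b + n).+1 i - p (b + n)%N i)) ^+ 2)); last first.
  by move=> i _; congr (_ ^+ 2); ring.
apply: sum_sqrD_le => //; last by apply: pc; rewrite leq_addr.
- by rewrite big_nat_cond sumr_ge0// => k /andP[/andP[bk _] _]; exact: c0.
- by apply: c0; rewrite leq_addr.
Qed.

(* [2^b] is the larger of [2^a] and of the first power of 2 above [sqrt N]. *)
Lemma split_level_exists (a : nat) : (0 < N)%N ->
  exists b : nat, [/\ (a <= b)%N, N%:R <= 4 ^+ b :> R,
    4 ^+ b <= 4 * N%:R + 4 ^+ a :> R &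
    forall n, (a <= n < b)%N -> 4 ^+ n <= N%:R :> R].
Proof.
move=> N0; have ex : exists n, (N <= 4 ^ n)%N by exists N; rewrite ltnW// ltn_expl.
have [n0 Nn0 minn0] := ex_minnP ex.
have small n : (n < n0)%N -> (4 ^ n < N)%N.
  by move=> nn0; rewrite ltnNge; apply: contraL nn0 => /minn0; rewrite -leqNgt.
have toR k : (4 ^+ k : R) = (4 ^ k)%N%:R by rewrite natrX.
exists (maxn a n0); split.
- exact: leq_maxl.
- by rewrite toR ler_nat (leq_trans Nn0)// leq_pexp2l// leq_maxr.
- have [an|na] := leqP a n0; last first.
    by rewrite lerDr mulr_ge0.
  apply: (@le_trans _ _ (4 * N%:R)); last by rewrite lerDl exprn_ge0.
  case: n0 Nn0 minn0 small an => [|n1] _ _ small _.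
    by rewrite expr0 -natrM ler1n muln_gt0.
  by rewrite exprS ler_pM2l// toR ler_nat ltnW// small.
- move=> n /andP[an]; rewrite leq_max ltnNge an/= => nn0.
  by rewrite toR ler_nat ltnW// small.
Qed.

(** The deterministic part, for one function and one outcome: [x] and [p n] are the sample values of
    the function and of its n-th approximation, [mx] and [mp n] their second moments, [r n] the
    distance between the two. [kappa] is the price of [s] from level [a] on: 2 if [4^a >= s], or
    [1 + s] if [a = 0]. *)
Lemma chain_bound x (mx : 'I_N -> R) (p mp : nat -> 'I_N -> R)
    (r dl : nat -> R) (alpha g s kappa K1 K2 K3 : R) (a : nat) :
  (0 < N)%N -> 0 <= alpha -> 0 <= s -> 1 <= kappa ->
  0 <= K1 -> 0 <= K2 -> 0 <= K3 ->
  (forall n, 0 <= r n) -> (forall n, 0 <= dl n) ->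
  (forall n, dl n <= r n + r n.+1) ->
  (forall n, \sum_(0 <= k < n) 2 ^+ k * r k <= g) ->
  (forall n, \sum_i (p n.+1 i ^+ 2 - p n i ^+ 2 - (mp n.+1 i - mp n i)) <=
    K1 * alpha * dl n *
    (Num.sqrt N%:R * Num.sqrt (4 ^+ n.+1 + s) + (4 ^+ n.+1 + s))) ->
  (forall n, \sum_i (p n.+1 i - p n i) ^+ 2 <=
    K2 * dl n ^+ 2 * (N%:R + (4 ^+ n.+1 + s))) ->
  (forall n, \sum_i p n i ^+ 2 <= K2 * alpha ^+ 2 * (N%:R + (4 ^+ n + s))) ->
  (forall n, \sum_i (mp n i - mx i) <= N%:R * (K3 * alpha * r n)) ->
  (forall e, 0 < e -> forall m,
     exists2 n, (m <= n)%N & \sum_i (x i - p n i) ^+ 2 <= e) ->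
  (forall n, (a <= n)%N -> 4 ^+ n + s <= kappa * 4 ^+ n) ->
  \sum_i (x i ^+ 2 - p a i ^+ 2 - (mx i - mp a i)) <=
  (15 * K2 + K3 + 9 * K1) * kappa *
  (g ^+ 2 + (Num.sqrt N%:R + 2 ^+ a) * alpha * g).
Proof.
move=> N0 al0 s0 k1 K10 K20 K30 r0 dl0 dlr rg hB hQ hQ0 hM hL ht.
have [b [ab Nb bN small]] := split_level_exists a N0.
set sN := Num.sqrt N%:R.
have sN0 : 0 <= sN := sqrtr_ge0 _.
have sNE : sN ^+ 2 = N%:R by rewrite sqr_sqrtr.
have k0 : 0 <= kappa := le_trans ler01 k1.
have pow4 n : 4 ^+ n = (2 ^+ n) ^+ 2 :> R.
  by rewrite -exprM mulnC exprM; congr (_ ^+ _); rewrite expr2 -natrM.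
have p2 n : 0 <= 2 ^+ n :> R by exact: exprn_ge0.
have g0 : 0 <= g by have := rg 0%N; rewrite big_geq.
(* A link is at most [r k + r k.+1]; the shifted sum gains 1/2 since [2^k = 2^(k+1) / 2], whence
   3/2. *)
have dlg m n : \sum_(m <= k < n) 2 ^+ k * dl k <= 3 / 2 * g.
  apply: (@le_trans _ _ (\sum_(0 <= k < n) 2 ^+ k * dl k)).
    have [mn|nm] := leqP m n; last first.
      rewrite big_geq ?(ltnW nm)// sumr_ge0// => k _.
      by rewrite mulr_ge0.
    by rewrite (big_cat_nat (leq0n m) mn)/= lerDr sumr_ge0// => k _; rewrite mulr_ge0.
  apply: (@le_trans _ _ (\sum_(0 <= k < n) 2 ^+ k * r k +
      2^-1 * \sum_(0 <= k < n.+1) 2 ^+ k * r k)); last first.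
    have := rg n; have := rg n.+1; lra.
  rewrite big_nat_recl//= mulrDr addrA [leRHS]addrAC -[leLHS]addr0.
  apply: lerD; last by rewrite expr0 mul1r mulr_ge0.
  rewrite mulr_sumr -big_split/=; apply: ler_sum => k _.
  rewrite exprS mulrA mulKf// -mulrDr.
  exact: ler_wpM2l.
have rb n : 2 ^+ n * r n <= g.
  apply: le_trans (rg n.+1); rewrite big_nat_recr//= lerDr sumr_ge0// => k _.
  by rewrite mulr_ge0.
(* For [k >= b], [N + 4^(k+1) + s <= 4^k + 4 kappa 4^k <= 5 kappa 4^k]. *)
pose cc := Num.sqrt (5 * K2 * kappa).
have cc0 : 0 <= cc := sqrtr_ge0 _.
have ccE : cc ^+ 2 = 5 * K2 * kappa by rewrite sqr_sqrtr// !mulr_ge0.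
(* Beyond level [b] the squares are not expanded along the chain: the chain is
   summed in the Euclidean norm and squared at the end. *)
have tailB : \sum_i (x i - p b i) ^+ 2 <= (3 / 2 * cc * g) ^+ 2.
  have B0 : 0 <= 3 / 2 * cc * g by rewrite !mulr_ge0.
  have c0 k : (b <= k)%N -> 0 <= cc * (2 ^+ k * dl k).
    by move=> _; rewrite mulr_ge0// mulr_ge0.
  have step k : (b <= k)%N ->
      \sum_i (p k.+1 i - p k i) ^+ 2 <= (cc * (2 ^+ k * dl k)) ^+ 2.
    move=> bk; apply: le_trans (hQ k) _.
    have h1 : N%:R <= 4 ^+ k :> R.
      by apply: (le_trans Nb); rewrite ler_eXn2l ?ltr1n.
    have h2 := ht k.+1 (leqW (leq_trans ab bk)).
    have h3 : N%:R + (4 ^+ k.+1 + s) <= 5 * kappa * 4 ^+ k.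
      have e4 : 0 <= 4 ^+ k :> R by exact: exprn_ge0.
      move: h2; rewrite exprS; nra.
    rewrite exprMn ccE exprMn -pow4.
    have -> : 5 * K2 * kappa * (4 ^+ k * dl k ^+ 2) =
      K2 * dl k ^+ 2 * (5 * kappa * 4 ^+ k) by ring.
    by apply: ler_wpM2l h3; rewrite mulr_ge0 ?sqr_ge0.
  (* [x] is a limit point of the chain: the chain is cut at an approximation within [e], and [e] is
     arbitrary. *)
  have sqrtle : Num.sqrt (\sum_i (x i - p b i) ^+ 2) <= 3 / 2 * cc * g.
    apply/ler_addgt0Pr => e e0.
    have [n bn hn] := hL _ (exprn_gt0 2 e0) b.
    have := sum_sqr_chain_le (n - b) c0 step; rewrite subnKC// => hc.
    have hs : \sum_(b <= k < n) cc * (2 ^+ k * dl k) <= 3 / 2 * cc * g.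
      have -> : 3 / 2 * cc * g = cc * (3 / 2 * g) by ring.
      by rewrite -mulr_sumr; apply: ler_wpM2l => //; exact: dlg.
    have hs0 : 0 <= \sum_(b <= k < n) cc * (2 ^+ k * dl k).
      by rewrite sumr_ge0// => k _; rewrite mulr_ge0// mulr_ge0.
    have := sum_sqrD_le (ltW e0) hs0 hn hc.
    under eq_bigr do rewrite subrKA.
    move=> h; rewrite -[leRHS]ger0_norm; last by rewrite addr_ge0// ltW.
    rewrite -sqrtr_sqr ler_wsqrtr// (le_trans h)//.
    rewrite ler_sqr ?nnegrE; last 2 first.
    - by rewrite addr_ge0// ltW.
    - by rewrite addr_ge0// ltW.
    by rewrite addrC lerD2r.
  have S0 : 0 <= \sum_i (x i - p b i) ^+ 2.
    by apply: sumr_ge0 => i _; exact: sqr_ge0.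
  by rewrite -[X in X <= _](sqr_sqrtr S0) ler_sqr ?nnegrE ?sqrtr_ge0.
(* The choice of [b] gives [N + 4^b + s <= N + kappa (4 N + 4^a) <= 5 kappa (sN + 2^a)^2]. *)
have headA : \sum_i p b i ^+ 2 <= (cc * alpha * (sN + 2 ^+ a)) ^+ 2.
  apply: le_trans (hQ0 b) _.
  rewrite !exprMn ccE.
  have -> : 5 * K2 * kappa * alpha ^+ 2 * (sN + 2 ^+ a) ^+ 2 =
      K2 * alpha ^+ 2 * (5 * kappa * (sN + 2 ^+ a) ^+ 2) by ring.
  apply: ler_wpM2l; first by rewrite mulr_ge0 ?sqr_ge0.
  have := ht b ab.
  have h1 : N%:R + 4 ^+ a <= (sN + 2 ^+ a) ^+ 2.
    by rewrite sqrrD sNE pow4; have := mulr_ge0 sN0 (p2 a); lra.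
  have Np : 0 <= N%:R :> R by [].
  have ap : 0 <= 4 ^+ a :> R by exact: exprn_ge0.
  move: bN; set B4 := 4 ^+ b; set A4 := 4 ^+ a in h1 ap *; nra.
have A0 : 0 <= cc * alpha * (sN + 2 ^+ a).
  by rewrite !mulr_ge0// addr_ge0.
have B0 : 0 <= 3 / 2 * cc * g by rewrite !mulr_ge0.
have cross := sum_mul_le A0 B0 headA tailB.
have upper : \sum_i (x i ^+ 2 - p b i ^+ 2 - (mx i - mp b i)) <=
    12 * K2 * kappa * g ^+ 2 +
    15 * K2 * kappa * (sN + 2 ^+ a) * alpha * g + K3 * sN * alpha * g.
  rewrite (eq_bigr (fun i => (x i - p b i) ^+ 2 +
      2 * (p b i * (x i - p b i)) + (mp b i - mx i))); last first.
    by move=> i _; ring.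
  rewrite 2!big_split/= -mulr_sumr.
  apply: lerD; last first.
    apply: le_trans (hM b) _.
    have h1 : N%:R * r b <= sN * g.
      have h2 : N%:R <= sN * 2 ^+ b.
        rewrite -sNE expr2; apply: ler_wpM2l => //.
        by rewrite -ler_sqr ?nnegrE// sNE -pow4.
      apply: le_trans (ler_wpM2r (r0 b) h2) _.
      by rewrite -mulrA; apply: ler_wpM2l.
    have -> : N%:R * (K3 * alpha * r b) = K3 * alpha * (N%:R * r b) by ring.
    have -> : K3 * sN * alpha * g = K3 * alpha * (sN * g) by ring.
    by apply: ler_wpM2l => //; rewrite mulr_ge0.
  apply: lerD.
    apply: (le_trans tailB); rewrite !exprMn ccE.
    have : 0 <= K2 * kappa * g ^+ 2 by rewrite !mulr_ge0// sqr_ge0.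
    by nra.
  apply: le_trans (ler_wpM2l (ler0n _ 2) cross) _.
  rewrite le_eqVlt; apply/orP; left; apply/eqP.
  transitivity (3 * cc ^+ 2 * alpha * (sN + 2 ^+ a) * g); last by rewrite ccE; ring.
  by field.
(* Here [4^n <= N], so the two terms of Bernstein's bound are at most 2 and 4 times [kappa sN 2^n];
   the factor 9 is [(2 + 4) * 3/2]. *)
have middle : \sum_i (p b i ^+ 2 - p a i ^+ 2 - (mp b i - mp a i)) <=
    9 * K1 * kappa * sN * alpha * g.
  have -> : \sum_i (p b i ^+ 2 - p a i ^+ 2 - (mp b i - mp a i)) =
    \sum_(a <= n < b)
      \sum_i (p n.+1 i ^+ 2 - p n i ^+ 2 - (mp n.+1 i - mp n i)).
    rewrite exchange_big/=; apply: eq_bigr => i _.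
    rewrite (eq_bigr (fun n => (p n.+1 i ^+ 2 - mp n.+1 i) - (p n i ^+ 2 - mp n i))).
      by rewrite telescope_sumr//; ring.
    by move=> n _; ring.
  apply: (@le_trans _ _ (\sum_(a <= n < b)
      6 * K1 * kappa * sN * alpha * (2 ^+ n * dl n))); last first.
    rewrite -mulr_sumr.
    have -> : 9 * K1 * kappa * sN * alpha * g =
        6 * K1 * kappa * sN * alpha * (3 / 2 * g) by field.
    by apply: ler_wpM2l => //; rewrite !mulr_ge0.
  rewrite big_nat_cond [leRHS]big_nat_cond; apply: ler_sum => n /andP[anb _].
  apply: le_trans (hB n) _.
  have h4 := small _ anb; have /andP[an _] := anb.
  have h2 := ht n.+1 (leqW an).
  have h2n : 2 ^+ n <= sN by rewrite -ler_sqr ?nnegrE// sNE -pow4.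
  have h5 : Num.sqrt (4 ^+ n.+1 + s) <= 2 * kappa * 2 ^+ n.
    rewrite -[leRHS]ger0_norm ?mulr_ge0// -sqrtr_sqr ler_wsqrtr//.
    apply: (le_trans h2); rewrite !exprMn exprS -pow4.
    have e4 : 0 <= 4 ^+ n :> R by exact: exprn_ge0.
    have : kappa <= kappa ^+ 2 by rewrite expr2; nra.
    by nra.
  have h6 : 4 ^+ n.+1 + s <= 4 * kappa * (sN * 2 ^+ n).
    apply: (le_trans h2).
    have : 4 ^+ n <= sN * 2 ^+ n by rewrite pow4 expr2; apply: ler_wpM2r.
    by rewrite exprS; nra.
  have -> : 6 * K1 * kappa * sN * alpha * (2 ^+ n * dl n) =
     K1 * alpha * dl n * (sN * (2 * kappa * 2 ^+ n) + 4 * kappa * (sN * 2 ^+ n)).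
    by ring.
  apply: ler_wpM2l; first by rewrite !mulr_ge0.
  by apply: lerD => //; apply: ler_wpM2l.
have -> : \sum_i (x i ^+ 2 - p a i ^+ 2 - (mx i - mp a i)) =
    \sum_i (x i ^+ 2 - p b i ^+ 2 - (mx i - mp b i)) +
    \sum_i (p b i ^+ 2 - p a i ^+ 2 - (mp b i - mp a i)).
  by rewrite -big_split/=; apply: eq_bigr => i _; ring.
apply: le_trans (lerD upper middle) _.
have ag0 : 0 <= alpha * g by rewrite mulr_ge0.
have e1 : 0 <= 2 ^+ a * (alpha * g) by rewrite mulr_ge0.
have e2 : 0 <= sN * (alpha * g) by rewrite mulr_ge0.
have e3 : 0 <= g ^+ 2 by exact: sqr_ge0.
have f1 : 0 <= K2 * kappa * g ^+ 2 by rewrite !mulr_ge0.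
have f2 : 0 <= K3 * kappa * g ^+ 2 by rewrite !mulr_ge0.
have f3 : 0 <= K1 * kappa * g ^+ 2 by rewrite !mulr_ge0.
have f4 : 0 <= K1 * kappa * (2 ^+ a * (alpha * g)) by rewrite mulr_ge0// mulr_ge0.
have f5 : 0 <= K3 * kappa * (2 ^+ a * (alpha * g)) by rewrite mulr_ge0// mulr_ge0.
have f6 : K3 * (sN * (alpha * g)) <= K3 * kappa * (sN * (alpha * g)).
  by apply: ler_wpM2r => //; rewrite ler_peMr.
lra.
Qed.

End chain_bound.

(** * Nets *)

Section enumeration.
Context {T : Type}.

Lemma injective_enum (A : set T) (f : T -> nat) : A !=set0 ->
  {in A &, injective f} ->
  exists e : nat -> T, (forall i, A (e i)) /\ (forall x, A x -> e (f x) = x).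
Proof.
move=> [x0 Ax0] finj.
have /boolp.choice[e eP] : forall i, exists x, A x /\
    forall y, A y -> f y = i -> x = y.
  move=> i; have [[y [Ay fy]]|H] := pselect (exists y, A y /\ f y = i).
    exists y; split => // z Az fz.
    by apply: finj; [exact/mem_set|exact/mem_set|exact: etrans fy (esym fz)].
  by exists x0; split => // y Ay fy; exfalso; apply: H; exists y.
exists e; split => [i|x Ax]; first by case: (eP i).
by have [_ /(_ x Ax erefl)] := eP (f x).
Qed.

Lemma card_le_enum (A : set T) (n : nat) : A !=set0 -> (A #<= `I_n)%card ->
  exists e : nat -> T, (forall i, A (e i)) /\
    (forall x, A x -> exists2 i, (i < n)%N & e i = x).
Proof.
move=> A0 /pcard_leP[f].
have [e [Ae eK]] := injective_enum A0 (@inj _ _ _ f).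
exists e; split => // x Ax; exists (f x); last exact: eK.
exact: (@funS _ _ _ _ f).
Qed.

Lemma countable_enum (A : set T) : A !=set0 -> countable A ->
  exists e : nat -> T, (forall i, A (e i)) /\
    (forall x, A x -> exists i, e i = x).
Proof.
move=> A0 /pcard_injP[f finj]; have [e [Ae eK]] := injective_enum A0 finj.
by exists e; split => // x Ax; exists (f x); exact: eK.
Qed.

End enumeration.

Section gamma2_nets.
Context {R : realType} {U : Type} (F D : set U) (d : U -> U -> R).
Context (F0 : F !=set0) (FD : F `<=` D) (distD : is_distance D d).

Let dist_nneg x y : F x -> F y -> 0 <= d x y.
Proof. by move=> Fx Fy; apply: (distance_ge0 distD); exact: FD. Qed.

Lemma dist_set_ge0 (Fn : nat -> set U) f n : admissible_nets F d Fn -> F f ->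
  0 <= dist_set d f (Fn n).
Proof.
move=> aF Ff; apply: lb_le_inf.
  by have [x Fx] := nets_nonempty aF n; exists (d f x), x.
by move=> _ [x Fx <-]; apply: dist_nneg => //; exact: (nets_sub aF Fx).
Qed.

Lemma dist_set_attained (Fn : nat -> set U) f n : admissible_nets F d Fn ->
  exists2 x, Fn n x & d f x <= dist_set d f (Fn n).
Proof.
move=> aF.
have [k Fk] : exists k, (Fn n #<= `I_k)%card.
  by have /finite_setP[k /card_eqPle[h _]] := nets_finite aF n; exists k.
have [e [Fe eF]] := card_le_enum (nets_nonempty aF n) Fk.
have [x Fx] := nets_nonempty aF n; have [i0 ik _] := eF x Fx.
pose j0 := Ordinal ik.
have [j _ jmin] := arg_minP (fun j : 'I_k => d f (e j)) (erefl : xpredT j0).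
exists (e j) => //; apply: lb_le_inf; first by exists (d f x), x.
move=> _ [y Fy <-]; have [i ik' <-] := eF y Fy.
exact: (jmin (Ordinal ik')).
Qed.

Let netsum (Fn : nat -> set U) f : \bar R :=
  (\sum_(0 <= n <oo) (2 ^+ n * dist_set d f (Fn n))%:E)%E.

Let netsum_term Fn f n : admissible_nets F d Fn -> F f ->
  (0 <= (2 ^+ n * dist_set d f (Fn n))%:E)%E.
Proof.
by move=> aF Ff; rewrite lee_fin mulr_ge0 ?exprn_ge0 ?dist_set_ge0.
Qed.

Lemma gamma2_ge0 : (0 <= gamma2 F d)%E.
Proof.
apply: le_ereal_inf_tmp => _ [Fn aF <-].
have [f Ff] := F0; apply: le_ereal_sup_tmp; exists (netsum Fn f); first by exists f.
by apply: nneseries_ge0 => n _ _; exact: netsum_term.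
Qed.

Let net_of_point f : F = [set f] -> admissible_nets F d (fun=> F).
Proof.
move=> FE; split => //.
- by move=> _; rewrite FE.
- by move=> _.
- by move=> _.
- by rewrite FE; exact: card_set1.
- move=> n n1; rewrite FE (card_le_eql card_set1).
  apply: subset_card_le => i /= i1.
  rewrite (leq_trans i1)// -ltnS prednK ?expn_gt0//.
  by rewrite -[X in (X < _)%N](expn0 2) ltn_exp2l// expn_gt0.
- move=> g Fg e e0; exists 0%N, g; split => //.
  by rewrite (distance_eq0 distD (FD Fg) (FD Fg)).2.
Qed.

(* The infimum need not be attained, so a factor 2 is lost; when it is 0,
   the family is a single point. *)
Lemma near_optimal_nets : (gamma2 F d < +oo)%E ->
  exists Fn : nat -> set U, exists g : R, [/\ admissible_nets F d Fn, 0 <= g,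
    (g%:E <= 2%:E * gamma2 F d)%E &
    forall f, F f -> (\sum_(0 <= n <oo) (2 ^+ n * dist_set d f (Fn n))%:E <=
      g%:E)%E].
Proof.
move=> goo; have gfin : gamma2 F d \is a fin_num by rewrite ge0_fin_numE ?gamma2_ge0.
set c := gamma2 F d in goo gfin *.
have [c0|c0] := eqVneq c 0%E; last first.
  have : (c < 2%:E * c)%E.
    have : (0 < c)%E by rewrite lt_def c0 gamma2_ge0.
    by rewrite -(fineK gfin) -EFinM !lte_fin; lra.
  move=> /ereal_inf_lt [_ [Fn aF <-]]; set v := ereal_sup _ => vc.
  have v0 : (0 <= v)%E.
    have [f Ff] := F0; apply: le_ereal_sup_tmp; exists (netsum Fn f); first by exists f.
    by apply: nneseries_ge0 => n _ _; exact: netsum_term.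
  have vfin : v \is a fin_num.
    by rewrite ge0_fin_numE// (lt_trans vc)// -(fineK gfin) -EFinM ltry.
  exists Fn, (fine v); split => //.
  - exact: fine_ge0.
  - by rewrite fineK// ltW.
  - by move=> f Ff; rewrite fineK//; apply: ereal_sup_ubound; exists f.
have [f Ff] := F0.
have FE : F = [set f].
  apply/seteqP; split => [h Fh|_ ->//].
  apply: ((distance_eq0 distD (FD Fh) (FD Ff)).1).
  apply/eqP; rewrite eq_le dist_nneg// andbT; apply/ler_addgt0Pr => e e0.
  rewrite add0r.
  (* Some nets have all their sums below [e / 2]; the term [n = 0] alone puts every member within
     [e / 2] of the single point of [Fn 0]. *)
  have : (c < (e / 2)%:E)%E by rewrite c0 lte_fin divr_gt0.
  move=> /ereal_inf_lt [_ [Fn aF <-]] ve.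
  have [x Fx xF0] : exists2 x, F x & forall y, F y -> d y x <= e / 2.
    have /card_eqPle[F01 F10] := nets_card0 aF.
    have [e1 [Fe eF]] := card_le_enum (nets_nonempty aF 0%N) F01.
    exists (e1 0%N); first exact: nets_sub aF _ _ (Fe 0%N).
    move=> y Fy; have [z Fz yz] := dist_set_attained y 0 aF.
    have [i] := eF z Fz; rewrite ltnS leqn0 => /eqP -> ->.
    apply: (le_trans yz); rewrite -lee_fin.
    apply: le_trans (ltW ve); apply: le_ereal_sup_tmp.
    exists (netsum Fn y); first by exists y.
    apply: (le_trans _ (nneseries_lim_ge 1%N _)); last first.
      by move=> k _ _; exact: netsum_term.
    by rewrite big_nat1 expr0 mul1r.
  apply: (le_trans (distance_triangle distD (FD Fh) (FD Fx) (FD Ff))).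
  rewrite [d x f](distance_sym distD (FD Fx) (FD Ff)).
  by have := xF0 h Fh; have := xF0 f Ff; lra.
exists (fun=> F), 0; split => //.
- exact: net_of_point FE.
- by rewrite c0 mule0.
- move=> h Fh; rewrite eseries0// => n _ _.
  rewrite (_ : dist_set d h F = 0) ?mulr0//.
  apply/eqP; rewrite eq_le (dist_set_ge0 0 (net_of_point FE) Fh) andbT.
  apply: ge_inf; first by exists 0 => _ [y Fy <-]; exact: dist_nneg.
  by exists h => //; exact: ((distance_eq0 distD (FD Fh) (FD Fh)).2).
Qed.

End gamma2_nets.

(** [B] serves the membership in the completed sigma-algebra and [D] the bound: the event whose
    probability is estimated may be larger than [E]. *)
Lemma completed_prob_leI {R : realType} {dO : measure_display}
    {Omega : measurableType dO} (P : probability Omega R)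
    (E B D : set Omega) (p : R) :
  measurable B -> measurable D -> {ae P, forall w, E w <-> B w} ->
  {ae P, forall w, E w -> D w} -> (P D <= p%:E)%E -> completed_prob_le P E p.
Proof.
move=> mB mD [M [mM M0 EB]] [M' [mM' M'0 ED]] PD; split.
  exists (B `\` M); first exact: measurableD.
  exists (E `&` M); first by exists M; split => //; exact: subIsetr.
  apply/seteqP; split => w.
    move=> [[Bw nMw]|[]//]; apply: contrapT => nE; apply: nMw; apply: EB => /=.
    by move=> /iffRL/(_ Bw).
  move=> Ew; have [Mw|nMw] := pselect (M w); first by right.
  left; split => //; apply: contrapT => nB; apply: nMw; apply: EB => /=.
  by move=> /iffLR/(_ Ew).
apply: le_trans PD.
apply: (@le_trans _ _ (P^*%mu (D `|` M'))).
  apply: le_mu_ext => w Ew; have [|] := pselect (M' w); first by right.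
  by move=> nM; left; apply: contrapT => nD; apply: nM; apply: ED => /= /(_ Ew).
rewrite measurable_mu_extE; last exact: measurableU.
apply: (le_trans (measureU2 _ _ _)) => //.
by rewrite [X in (_ + X)%E](_ : _ = 0%E) ?adde0.
Qed.

Lemma cvg_sum_ord {R : realType} (n : nat) (u : 'I_n -> nat -> R)
    (l : 'I_n -> R) : (forall i, u i k @[k --> \oo] --> l i) ->
  \sum_i u i k @[k --> \oo] --> \sum_i l i.
Proof.
move=> ul; elim: (index_enum _) => [|i s ih].
  by under eq_fun do rewrite big_nil; rewrite big_nil; exact: cvg_cst.
under eq_fun do rewrite big_cons.
by rewrite big_cons; apply: cvgD.
Qed.

(** * Bounds on the process *)

Section process_bounds.
Context {R : realType} {dO dX : measure_display} {Omega : measurableType dO}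
  {TX : measurableType dX} (P : probability Omega R) (N : nat)
  (X : 'I_N -> {RV P >-> TX}).
Context (F : set (TX -> R)) (d : (TX -> R) -> (TX -> R) -> R) (alpha : R).

Local Notation G := (F `|` [set cst 0]).

Context (N_gt0 : (0 < N)%N) (indep : mutually_independent P X)
  (F_neq0 : F !=set0)
  (mG : forall f, G f -> measurable_fun setT f) (distG : is_distance G d)
  (tailG : forall f g, G f -> G g -> forall (i : 'I_N) (u : R), 0 < u ->
     (P [set w | (u <= `|f (X i w) - g (X i w)|)%R] <=
       (2 * gauss_tail u (d f g))%:E)%E)
  (sepF : separable_process P X F d)
  (dG_le : forall f, G f -> d f (cst 0) <= alpha).

Let FG : F `<=` G. Proof. by move=> f; left. Qed.

Let G0 : G (cst 0). Proof. by right. Qed.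

Let C0_ge0 : 0 <= exp_moment_bound :> R.
Proof. exact: le_trans ler01 exp_moment_bound_ge1. Qed.

Let alpha_ge0 : 0 <= alpha := dist_alpha_ge0 distG G0 dG_le.

(** From [chain_bound] with [K1 = bern_const], [K2 = dsq_const] and [K3 = 8 * exp_moment_bound], the
    last by [mean_sq_diff_le]. *)
Definition chain_const : R :=
  15 * dsq_const + 8 * exp_moment_bound + 9 * bern_const.

Lemma chain_const_ge0 : 0 <= chain_const.
Proof.
rewrite /chain_const; have := @bern_const_ge0 R; have := @dsq_const_ge0 R.
by have := C0_ge0; lra.
Qed.

(** [N] times the chaining term at a value [g] of the functional. *)
Definition chain_rate (g : R) : R := g ^+ 2 + Num.sqrt N%:R * alpha * g.

(** [(1 + z)^2 >= 2]. This is how the lower bound on [Z] is used. *)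
Let log2_ge_half (z : R) : 2^-1 <= z -> 2^-1 <= log2 (1 + z).
Proof.
move=> z2; have ln2_gt0 : 0 < ln 2 :> R by rewrite ln_gt0// ltr1n.
rewrite /log2 ler_pdivlMr//.
have : ln 2 <= ln ((1 + z) * (1 + z)) by rewrite ler_ln ?posrE; nra.
by rewrite lnM ?posrE; lra.
Qed.

(** Both parts of [csq] pass to the limit: the sample values by separability, the means because
    [mean_sq_diff_le] makes them Lipschitz in [d]. *)
Lemma separable_csq_le (F' : set (TX -> R)) (g : TX -> R) (f : TX -> R) (c : R)
    (w : Omega) : F f -> F' `<=` F -> G g ->
  (exists fk : nat -> TX -> R, [/\ forall k, F' (fk k),
    d (fk k) f @[k --> \oo] --> (0 : R) &
    forall i, fk k (X i w) @[k --> \oo] --> f (X i w)]) ->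
  (forall h, F' h -> csq X h g w <= c) -> csq X f g w <= c.
Proof.
move=> Ff F'F Gg [fk [F'fk dfk fkX]] hc.
have mean_cvg i : mean_sq X (fk k) i @[k --> \oo] --> mean_sq X f i.
  apply/cvgrPdist_le => e e0.
  pose K := exp_moment_bound * (8 * alpha) + 1.
  have K0 : 0 < K by rewrite ltr_wpDl// mulr_ge0// mulr_ge0.
  have eK : 0 < e / K by rewrite divr_gt0.
  have /cvgrPdist_le/(_ _ eK) := dfk.
  apply: filterS => k; rewrite sub0r normrN.
  have Gk : G (fk k) by apply/FG/F'F.
  have Gf := FG Ff.
  rewrite ger0_norm ?(dist_ge0 distG)// ler_pdivlMr// => dk.
  have h1 := mean_sq_diff_le mG distG tailG G0 dG_le i Gk Gf.
  have h2 := mean_sq_diff_le mG distG tailG G0 dG_le i Gf Gk.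
  rewrite /bern_scale (distance_sym distG Gf Gk) in h2.
  rewrite /bern_scale in h1.
  have d0 := dist_ge0 distG Gk Gf.
  have : exp_moment_bound * (8 * alpha * d (fk k) f) <= e.
    by apply: le_trans dk; rewrite /K; lra.
  by rewrite ler_norml; lra.
have cvg_csq : csq X (fk k) g w @[k --> \oo] --> csq X f g w.
  apply: cvg_sum_ord => i; apply: cvgB; apply: cvgB.
  - by rewrite expr2; under eq_fun do rewrite expr2; apply: cvgM.
  - exact: cvg_cst.
  - exact: mean_cvg.
  - exact: cvg_cst.
have <- := cvg_lim (@Rhausdorff R) cvg_csq.
apply: limr_le; first by apply: cvgP cvg_csq.
by apply: nearW => k; exact: hc.
Qed.

(** One null event serves all [f], [g] and [c]. Such a sequence reduces the chaining to countably
    many functions and, later, the deviation event to a countable union. *)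
Lemma separable_enum : exists2 fs : nat -> TX -> R, forall j, F (fs j) &
  {ae P, forall w f g (c : R), F f -> G g ->
    (forall j, csq X (fs j) g w <= c) -> csq X f g w <= c}.
Proof.
have [F' [F'count F'F aeF']] := sepF.
(* If [F'] were empty, every outcome would be exceptional, since [F] has a member to approximate. *)
have F'0 : F' !=set0.
  apply/set0P/negP => /eqP F'E.
  have : {ae P, forall w, False}.
    apply: filterS aeF' => w H; have [f Ff] := F_neq0.
    by have [fk [/(_ 0%N)]] := H f Ff; rewrite F'E.
  move=> [M [mM M0 H]].
  have MT : M = setT by apply/seteqP; split => // w _; exact: H.
  by move: M0; rewrite MT probability_setT => /eqP; rewrite onee_eq0.
have [fs [F'fs fsF']] := countable_enum F'0 F'count.
exists fs; first by move=> j; exact/F'F/F'fs.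
apply: filterS aeF' => w H f g c Ff Gg hc.
by apply: (separable_csq_le Ff F'F Gg (H f Ff)) => h /fsF' [j <-].
Qed.

Lemma process_bounds : (gamma2 F d < +oo)%E ->
  exists Z : Omega -> R, exists g : R, exists f0 : TX -> R,
  [/\ [/\ measurable_fun setT Z, forall w, 2^-1 <= Z w & ('E_P[Z] <= 1)%E],
      0 <= g, (g%:E <= 2%:E * gamma2 F d)%E, F f0 &
      {ae P, forall w f, F f -> let s := log2 (1 + Z w) in
        csq X f (cst 0) w <= 3 * chain_const * chain_rate g +
          (4 * chain_const + 5 * bern_const) * alpha ^+ 2 *
            (Num.sqrt N%:R * Num.sqrt s + s) /\
        csq X f f0 w <= 2 * chain_const * (1 + s) * chain_rate g}].
Proof.
move=> goo.
have [Fn [g [aF g0 gle sumle]]] := near_optimal_nets F_neq0 FG distG goo.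
have [fs Fs aeF'] := separable_enum.
(* At level [n], the indices below [net_size n - 1] enumerate the net, and the
   remaining one is the zero function. *)
have /boolp.choice[en enP] : forall n, exists e : nat -> TX -> R,
    (forall i, Fn n (e i)) /\
    (forall x, Fn n x -> exists2 i, (i < (net_size n).-1)%N & e i = x).
  move=> n; apply: card_le_enum; first exact: nets_nonempty aF n.
  case: n => [|n]; last exact: nets_card aF _ _.
  by have /card_eqPle[h _] := nets_card0 aF.
pose e n i := if (i < (net_size n).-1)%N then en n i else cst 0.
have Ge n i : G (e n i).
  rewrite /e; case: ifP => _; last exact: G0.
  by apply/FG/(nets_sub aF); have [h _] := enP n; exact: h.
have e_net n x : Fn n x -> exists2 i, (i < net_size n)%N & e n i = x.
  have [_ h] := enP n => /h [i ilt eix]; exists i; last by rewrite /e ilt.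
  by rewrite (leq_trans ilt)// leq_pred.
have e_zero n : exists2 i, (i < net_size n)%N & e n i = cst 0.
  exists (net_size n).-1; last by rewrite /e ltnn.
  by rewrite ltn_predL net_size_gt0.
have /boolp.choice[p pP] : forall fn : (TX -> R) * nat, exists x, Fn fn.2 x /\
    d fn.1 x <= dist_set d fn.1 (Fn fn.2).
  by move=> [f n]; have [x Fx hx] := dist_set_attained f n aF; exists x.
have pF f n : Fn n (p (f, n)) by have [] := pP (f, n).
have pd f n : d f (p (f, n)) <= dist_set d f (Fn n) by have [] := pP (f, n).
have Gp f n : G (p (f, n)) by apply/FG/(nets_sub aF); exact: pF.
have [f0 Ff0 pf0] : exists2 f0, F f0 & forall f, p (f, 0%N) = f0.
  exists (en 0%N 0%N).
    by apply: (nets_sub aF) ((enP 0%N).1 0%N).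
  move=> f; have [i] := (enP 0%N).2 _ (pF f 0%N).
  by rewrite ltnS leqn0 => /eqP ->.
have [Z [mZ Z2 EZ aeZ]] := chaining_variable N_gt0 indep mG distG tailG G0 dG_le
  Ge (fun j n => FG (Fs j)) (fun j n => Gp (fs j) n).
exists Z, g, f0; split => //.
(* The starting level depends on the outcome, so the chaining is stated for a fixed [w] and every
   [a]. *)
have core w :
    (forall n (i j : nat), (i < net_size n)%N -> (j < net_size n)%N ->
        let t := 4 ^+ n + log2 (1 + Z w) in
        csq X (e n i) (e n j) w <= bern_const * alpha * d (e n i) (e n j) *
          (Num.sqrt N%:R * Num.sqrt t + t) /\
        dsq X (e n i) (e n j) w <=
          dsq_const * d (e n i) (e n j) ^+ 2 * (N%:R + t)) ->
    (forall (j n : nat), (j <= n)%N ->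
        dsq X (fs j) (p (fs j, n)) w <=
          dsq_const * d (fs j) (p (fs j, n)) ^+ 2 *
            (N%:R + (n%:R + log2 (1 + Z w)))) ->
    forall j kappa (a : nat), 1 <= kappa ->
      (forall n, (a <= n)%N -> 4 ^+ n + log2 (1 + Z w) <= kappa * 4 ^+ n) ->
      csq X (fs j) (p (fs j, a)) w <= chain_const * kappa *
        (g ^+ 2 + (Num.sqrt N%:R + 2 ^+ a) * alpha * g).
  move=> Hlev Htail j kappa a k1 hk; set f := fs j; set s := log2 _ in hk *.
  have s0 : 0 <= s by rewrite (le_trans _ (log2_ge_half (Z2 w))).
  pose r n := d f (p (f, n)); pose dl n := d (p (f, n.+1)) (p (f, n)).
  have r0 n : 0 <= r n by exact: (dist_ge0 distG (FG (Fs j)) (Gp f n)).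
  have dl0 n : 0 <= dl n by exact: (dist_ge0 distG).
  have sumr n : \sum_(0 <= k < n) 2 ^+ k * r k <= g.
    rewrite -lee_fin; apply: le_trans (sumle f (Fs j)).
    apply: (@le_trans _ _
        (\sum_(0 <= k < n) (2 ^+ k * dist_set d f (Fn k))%:E)%E).
      rewrite -sumEFin; apply: lee_sum => k _; rewrite lee_fin.
      by apply: ler_wpM2l; rewrite ?exprn_ge0//; exact: pd.
    apply: nneseries_lim_ge => k _ _; rewrite lee_fin mulr_ge0 ?exprn_ge0//.
    by apply: (dist_set_ge0 FG distG _ aF); exact: Fs.
  have rb n : 2 ^+ n * r n <= g.
    apply: le_trans (sumr n.+1); rewrite big_nat_recr//= lerDr.
    by apply: sumr_ge0 => k _; rewrite mulr_ge0 ?exprn_ge0.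
  have lev n : csq X (p (f, n.+1)) (p (f, n)) w <=
        bern_const * alpha * dl n *
          (Num.sqrt N%:R * Num.sqrt (4 ^+ n.+1 + s) + (4 ^+ n.+1 + s)) /\
      dsq X (p (f, n.+1)) (p (f, n)) w <=
        dsq_const * dl n ^+ 2 * (N%:R + (4 ^+ n.+1 + s)).
    (* The nets are nested: both ends of the link lie in the net of level [n + 1], and one estimate
       of that level applies. *)
    have [i im ei] := e_net n.+1 _ (pF f n.+1).
    have [i' im' ei'] := e_net n.+1 _ (nets_nondecreasing aF (pF f n)).
    by have := Hlev n.+1 i i' im im'; rewrite ei ei'.
  apply: (@chain_bound R N (fun i => f (X i w)) (mean_sq X f)
    (fun n i => p (f, n) (X i w)) (fun n => mean_sq X (p (f, n))) r dl alpha g s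
    kappa bern_const dsq_const (8 * exp_moment_bound) a) => //.
  - exact: bern_const_ge0.
  - exact: dsq_const_ge0.
  - by rewrite mulr_ge0.
  - move=> n; rewrite /dl /r.
    apply: (le_trans (distance_triangle distG (Gp f n.+1) (FG (Fs j)) (Gp f n))).
    by rewrite (distance_sym distG (Gp f n.+1) (FG (Fs j))) addrC.
  - by move=> n; have [] := lev n.
  - by move=> n; have [] := lev n.
  - move=> n; have [i im ei] := e_net n _ (pF f n).
    have [i' im' ei'] := e_zero n.
    have [_] := Hlev n i i' im im'; rewrite ei ei' => h.
    rewrite (_ : \sum_i _ = dsq X (p (f, n)) (cst 0) w); last first.
      by apply: eq_bigr => k _; rewrite subr0.
    apply: (le_trans h); apply: ler_wpM2r.
      by rewrite addr_ge0// addr_ge0// exprn_ge0.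
    apply: ler_wpM2l; first exact: dsq_const_ge0.
    rewrite ler_sqr ?nnegrE//; last by exact: (dist_ge0 distG).
    exact: dG_le.
  - move=> n; rewrite mulr_natl -[X in _ *+ X](card_ord N) -sumr_const.
    apply: ler_sum => i _.
    have := mean_sq_diff_le mG distG tailG G0 dG_le i (Gp f n) (FG (Fs j)).
    move=> /le_trans; apply.
    rewrite /bern_scale (distance_sym distG (Gp f n) (FG (Fs j))) /r.
    by rewrite le_eqVlt; apply/orP; left; apply/eqP; ring.
  (* [r n <= g 2^-n] while [N + n + s <= (N + 1 + s) 2^n], so the squared norm is at most [c 2^-n];
     [n >= j] makes the pair available. *)
  - move=> eps eps0 m.
    pose c := dsq_const * g ^+ 2 * (N%:R + 1 + s).
    have c0 : 0 <= c.
      rewrite mulr_ge0//; last by rewrite addr_ge0.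
      by rewrite mulr_ge0 ?sqr_ge0 ?dsq_const_ge0.
    pose k := (Num.trunc (c / eps)).+1.
    have ck : c / eps < k%:R.
      by have /andP[] := truncn_itv (divr_ge0 c0 (ltW eps0)).
    have [n [mn jn kn]] : exists n, [/\ (m <= n)%N, (j <= n)%N & (k <= n)%N].
      by exists (maxn (maxn m j) k); split; rewrite !leq_max leqnn ?orbT.
    exists n => //.
    apply: (le_trans (Htail j n jn)); rewrite -/f -/s -/(r n).
    have p2 : 0 < 2 ^+ n :> R by rewrite exprn_gt0.
    have n2 : n%:R <= 2 ^+ n :> R by rewrite -natrX ler_nat ltnW// ltn_expl.
    have p1 : 1 <= 2 ^+ n :> R by rewrite exprn_ege1// ler1n.
    have cn : c <= eps * 2 ^+ n.
      rewrite mulrC -ler_pdivrMr// (le_trans (ltW ck))// (le_trans _ n2)//.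
      by rewrite ler_nat.
    have h1 : N%:R + (n%:R + s) <= (N%:R + 1 + s) * 2 ^+ n.
      rewrite !mulrDl mul1r addrA.
      by do 2?apply: lerD => //; rewrite ler_peMr.
    apply: (@le_trans _ _ (dsq_const * r n ^+ 2 * ((N%:R + 1 + s) * 2 ^+ n))).
      by apply: ler_wpM2l h1; rewrite mulr_ge0 ?sqr_ge0 ?dsq_const_ge0.
    rewrite -(ler_pM2r p2); apply: le_trans cn.
    have arrange (x y z t : R) : x * y ^+ 2 * (z * t) * t = x * (t * y) ^+ 2 * z.
      by ring.
    rewrite arrange.
    apply: ler_wpM2r; first by rewrite addr_ge0.
    apply: ler_wpM2l; first exact: dsq_const_ge0.
    by rewrite ler_sqr ?nnegrE// mulr_ge0 ?exprn_ge0.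
apply: filterS2 aeZ aeF' => w [Hlev Htail] sepw f Ff.
set s := log2 (1 + Z w).
have s2 : 2^-1 <= s := log2_ge_half (Z2 w).
have s0 : 0 <= s by rewrite (le_trans _ s2).
have sN0 : 0 <= Num.sqrt N%:R :> R := sqrtr_ge0 _.
have KC := chain_const_ge0.
have ag0 : 0 <= alpha * g by rewrite mulr_ge0.
split.
- apply: (sepw f (cst 0) _ Ff G0) => j.
  have ex : exists n, s <= 4 ^+ n.
    exists (Num.trunc s).+1.
    have /andP[_ h1] := truncn_itv s0.
    apply: (le_trans (ltW h1)).
    by rewrite -natrX ler_nat ltnW// ltn_expl.
  have [a sa amin] := ex_minnP ex.
  (* Minimality of [a] gives this unless [a = 0], where [s >= 1/2] does. *)
  have a4 : 4 ^+ a <= 4 * s.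
    case: a sa amin => [|a] _ amin; first by rewrite expr0; lra.
    rewrite exprS ler_pM2l// leNgt; apply/negP => h1.
    by have := amin a (ltW h1); rewrite ltnn.
  have hk n : (a <= n)%N -> 4 ^+ n + s <= 2 * 4 ^+ n.
    move=> an; rewrite (mulrDl 1 1) mul1r lerD2l (le_trans sa)//.
    by rewrite ler_eXn2l ?ltr1n.
  have h1 := core w Hlev Htail j 2 a (ler1n _ _) hk.
  have [i im ei] := e_net a _ (pF (fs j) a).
  have [i' im' ei'] := e_zero a.
  have [h2 _] := Hlev a i i' im im'; rewrite ei ei' -/s in h2.
  rewrite (csq_trans X (p (fs j, a))).
  have h3 : csq X (p (fs j, a)) (cst 0) w <=
      5 * bern_const * alpha ^+ 2 * (Num.sqrt N%:R * Num.sqrt s + s).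
    apply: (le_trans h2).
    have h4 : bern_const * alpha * d (p (fs j, a)) (cst 0) <=
        bern_const * alpha ^+ 2.
      rewrite expr2 mulrA; apply: ler_wpM2l; last exact: dG_le.
      by rewrite mulr_ge0 ?bern_const_ge0.
    apply: (le_trans (ler_wpM2r _ h4)).
      by rewrite addr_ge0 ?mulr_ge0 ?sqrtr_ge0// addr_ge0// exprn_ge0.
    have -> : 5 * bern_const * alpha ^+ 2 * (Num.sqrt N%:R * Num.sqrt s + s) =
      bern_const * alpha ^+ 2 * (Num.sqrt N%:R * (5 * Num.sqrt s) + 5 * s) by ring.
    apply: ler_wpM2l; first by rewrite mulr_ge0 ?bern_const_ge0 ?sqr_ge0.
    apply: lerD; last by lra.
    apply: ler_wpM2l => //.
    rewrite -ler_sqr ?nnegrE ?mulr_ge0 ?sqrtr_ge0//.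
    rewrite exprMn !sqr_sqrtr//; last by rewrite addr_ge0// exprn_ge0.
    by lra.
  have h5 : 2 * (2 ^+ a * (alpha * g)) <= 4 * s * alpha ^+ 2 + g ^+ 2.
    have h6 : 0 <= (2 ^+ a * alpha - g) ^+ 2 := sqr_ge0 _.
    have p4 : (2 ^+ a) ^+ 2 = 4 ^+ a :> R.
      by rewrite -exprM mulnC exprM; congr (_ ^+ _); rewrite expr2 -natrM.
    have h7 : 4 ^+ a * alpha ^+ 2 <= 4 * s * alpha ^+ 2.
      by apply: ler_wpM2r => //; exact: sqr_ge0.
    rewrite sqrrB exprMn p4 in h6.
    by lra.
  have h8 : chain_const * (2 * (2 ^+ a * (alpha * g))) <=
      chain_const * (4 * s * alpha ^+ 2 + g ^+ 2) by exact: ler_wpM2l.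
  have h9 : 0 <= chain_const * (Num.sqrt N%:R * (alpha * g)).
    by rewrite mulr_ge0// mulr_ge0.
  have h10 : 0 <= chain_const * alpha ^+ 2 * (Num.sqrt N%:R * Num.sqrt s).
    by rewrite mulr_ge0 ?mulr_ge0 ?sqr_ge0 ?sqrtr_ge0.
  by rewrite /chain_rate; lra.
(* From level 0, where all chains start at [f0], with [kappa = 1 + s]; [sqrt N + 1 <= 2 sqrt N]
   gives the factor 2. *)
- have Gf0 := FG Ff0.
  apply: (sepw f f0 _ Ff Gf0) => j.
  have hk n : (0 <= n)%N -> 4 ^+ n + s <= (1 + s) * 4 ^+ n.
    move=> _; rewrite mulrDl mul1r lerD2l ler_peMr// exprn_ege1// ler1n//.
  have k1 : 1 <= 1 + s by rewrite lerDl.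
  have := core w Hlev Htail j (1 + s) 0%N k1 hk; rewrite pf0 expr0.
  move=> /le_trans; apply.
  have sN1 : 1 <= Num.sqrt N%:R :> R.
    by rewrite -[X in X <= _]sqrtr1 ler_wsqrtr// ler1n.
  rewrite /chain_rate.
  have -> : 2 * chain_const * (1 + s) * (g ^+ 2 + Num.sqrt N%:R * alpha * g) =
    chain_const * (1 + s) * (2 * (g ^+ 2 + Num.sqrt N%:R * alpha * g)) by ring.
  apply: ler_wpM2l; first by rewrite mulr_ge0// addr_ge0.
  have := sqr_ge0 g.
  have : 1 * (alpha * g) <= Num.sqrt N%:R * (alpha * g) by exact: ler_wpM2r.
  by lra.
Qed.

End process_bounds.

(** * Constants, and the two forms of the deviation bound *)

Section rate_constants.
Context {R : realType}.

(** The factors 3 and 2 of [process_bounds] are multiplied by 4, the cost of [g <= 2 gamma2] in a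
    square; [rate_const2] doubles since [sqrt s] and [s / sqrt N] are each at most [phi_inv N Z].
    The added 1 gives strict positivity, for the case of infinite gamma2. *)
Definition rate_const1 : R := 12 * chain_const + 1.
Definition rate_const2 : R := 2 * (4 * chain_const + 5 * bern_const).
Definition rate_const3 : R := 8 * chain_const.
(* For [u < 1] Chernoff's bound is used at the parameter [small_const * u]. *)
Definition small_const : R := (32 + 4 * rate_const3)^-1.
(** [4 * rate_const2] pays for the deviation at [u = 1] when [alpha^2 / sqrt N] is at most the
    chaining term; [3 * rate_const3] lowers a factor [1 + s] to [s - 2]. *)
Definition dev_const1 : R := rate_const1 + 4 * rate_const2 + 3 * rate_const3.
Definition small_mgf_const : R := 16 * exp_moment_bound * (16 * 16).
(** The first term serves large [u]. With the second, [small_const * dev_const2] exceeds the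
    quadratic cost of the exponential moment by at least 1, which leaves an exponent at most
    [- u^2]. *)
Definition dev_const2 : R :=
  4 * rate_const2 + (1 + small_mgf_const * small_const ^+ 2) / small_const.

Lemma rate_const1_gt0 : 0 < rate_const1.
Proof. by rewrite /rate_const1; have := @chain_const_ge0 R; lra. Qed.

Lemma rate_const2_ge0 : 0 <= rate_const2.
Proof.
rewrite /rate_const2; have := @chain_const_ge0 R; have := @bern_const_ge0 R.
by lra.
Qed.

Lemma rate_const3_ge0 : 0 <= rate_const3.
Proof. by rewrite /rate_const3; have := @chain_const_ge0 R; lra. Qed.

Lemma small_const_gt0 : 0 < small_const.
Proof. by rewrite invr_gt0; have := rate_const3_ge0; lra. Qed.

Lemma dev_const1_gt0 : 0 < dev_const1.
Proof.
rewrite /dev_const1; have := rate_const1_gt0; have := rate_const2_ge0.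
by have := rate_const3_ge0; lra.
Qed.

Lemma small_mgf_const_ge0 : 0 <= small_mgf_const.
Proof.
apply: mulr_ge0; last exact: mulr_ge0.
by apply: mulr_ge0 => //; apply: le_trans ler01 exp_moment_bound_ge1.
Qed.

Lemma dev_const2_ge : 4 * rate_const2 <= dev_const2.
Proof.
rewrite /dev_const2 lerDl; apply: divr_ge0; last exact: ltW small_const_gt0.
apply: addr_ge0 => //; apply: mulr_ge0; first exact: small_mgf_const_ge0.
exact: sqr_ge0.
Qed.

Lemma small_dev_const :
  1 + small_mgf_const * small_const ^+ 2 <= small_const * dev_const2.
Proof.
have s0 := small_const_gt0.
rewrite /dev_const2 mulrDr (mulrCA small_const _ small_const^-1).
rewrite divff ?gt_eqF// mulr1 lerDr mulr_ge0 ?(ltW s0)// mulr_ge0//.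
exact: rate_const2_ge0.
Qed.

End rate_constants.

Section concentration.
Context {R : realType} {dO dX : measure_display} {Omega : measurableType dO}
  {TX : measurableType dX} (P : probability Omega R) (N : nat)
  (X : 'I_N -> {RV P >-> TX}).
Context (F : set (TX -> R)) (d : (TX -> R) -> (TX -> R) -> R) (alpha : R).

Local Notation G := (F `|` [set cst 0]).

Context (N_gt0 : (0 < N)%N) (indep : mutually_independent P X)
  (F_neq0 : F !=set0)
  (mG : forall f, G f -> measurable_fun setT f) (distG : is_distance G d)
  (tailG : forall f g, G f -> G g -> forall (i : 'I_N) (u : R), 0 < u ->
     (P [set w | (u <= `|f (X i w) - g (X i w)|)%R] <=
       (2 * gauss_tail u (d f g))%:E)%E)
  (sepF : separable_process P X F d)
  (dG_le : forall f, G f -> d f (cst 0) <= alpha).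

Let FG : F `<=` G. Proof. by move=> f; left. Qed.

Let G0 : G (cst 0). Proof. by right. Qed.

Let alpha_ge0 : 0 <= alpha := dist_alpha_ge0 distG G0 dG_le.

Let N0 : 0 < N%:R :> R. Proof. by rewrite ltr0n. Qed.

Let sN := Num.sqrt N%:R : R.

Let sN_ge1 : 1 <= sN.
Proof. by rewrite -[X in X <= _]sqrtr1 ler_wsqrtr// ler1n. Qed.

Let sN_gt0 : 0 < sN := lt_le_trans ltr01 sN_ge1.

Let sNE : N%:R = sN * sN :> R.
Proof. by rewrite -expr2 sqr_sqrtr. Qed.

Let ln2_half : 2^-1 <= ln 2 :> R.
Proof.
have := @le_ln1Dx R (- 2^-1) ltac:(lra).
have -> : 1 + - 2^-1 = 2^-1 :> R by lra.
by rewrite lnV ?posrE//; lra.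
Qed.

Let ln2_gt0 : 0 < ln 2 :> R. Proof. by rewrite (lt_le_trans _ ln2_half). Qed.

Let C0_ge0 : 0 <= exp_moment_bound :> R.
Proof. exact: le_trans ler01 exp_moment_bound_ge1. Qed.

Let K1_ge0 : 0 <= chain_const :> R := chain_const_ge0.
Let K2_ge0 : 0 <= bern_const :> R := bern_const_ge0.
Let rate1_gt0 : 0 < rate_const1 :> R := rate_const1_gt0.
Let rate2_ge0 : 0 <= rate_const2 :> R := rate_const2_ge0.
Let rate3_ge0 : 0 <= rate_const3 :> R := rate_const3_ge0.
Let small_gt0 : 0 < small_const :> R := small_const_gt0.

Definition chain_real (x : R) : R := N%:R^-1 * x ^+ 2 + sN^-1 * alpha * x.

Lemma chaining_termE (x : R) : chaining_term N alpha x%:E = (chain_real x)%:E.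
Proof. by rewrite /chaining_term -EFin_expe -!EFinM -EFinD. Qed.

Lemma chain_real_ge0 x : 0 <= x -> 0 <= chain_real x.
Proof.
move=> x0; rewrite addr_ge0// mulr_ge0 ?invr_ge0 ?sqr_ge0//.
by rewrite mulr_ge0// invr_ge0 ltW.
Qed.

Lemma chain_rate_le (g c : R) : 0 <= g -> g <= 2 * c ->
  N%:R^-1 * chain_rate N alpha g <= 4 * chain_real c.
Proof.
move=> g0 gc; have c0 : 0 <= c by lra.
rewrite /chain_rate /chain_real -/sN mulrDr mulrDr.
apply: lerD.
  have -> : 4 * (N%:R^-1 * c ^+ 2) = N%:R^-1 * (4 * c ^+ 2) by ring.
  by apply: ler_wpM2l; rewrite ?invr_ge0// !expr2; nra.
have -> : N%:R^-1 * (sN * alpha * g) = sN^-1 * alpha * g.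
  by rewrite sNE; field; rewrite gt_eqF.
have -> : 4 * (sN^-1 * alpha * c) = sN^-1 * alpha * (4 * c) by ring.
apply: ler_wpM2l; first by rewrite mulr_ge0// invr_ge0 ltW.
by lra.
Qed.

Lemma sup_centered_squaresE w : sup_centered_squares P X F w =
  ereal_sup [set (N%:R^-1 * csq X f (cst 0) w)%:E | f in F].
Proof.
congr ereal_sup; apply/eq_imagel => f Ff.
rewrite EFinM; congr (_ * _)%E.
rewrite /csq -sumEFin; apply: eq_bigr => i _.
rewrite (sq_expectation mG distG tailG G0 i (FG Ff)) -EFinB.
by rewrite mean_sq_cst0 /= expr0n/= !subr0.
Qed.

Lemma sup_centered_squares_leP w (c : R) :
  (sup_centered_squares P X F w <= c%:E)%E <->
  (forall f, F f -> N%:R^-1 * csq X f (cst 0) w <= c).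
Proof.
rewrite sup_centered_squaresE; split=> [h f Ff|h].
  by rewrite -lee_fin; apply: le_trans h; apply: ereal_sup_ubound; exists f.
by apply: ge_ereal_sup => _ [f Ff <-]; rewrite lee_fin h.
Qed.

(** With [m] the minimum, the hypothesis gives [log2 (1 + z) >= 4 m], so [1 + z >= e^(2 m)] by
    [ln 2 >= 1/2]; as [m >= 1], [e^(2 m) - 1 >= e^m]. The factor 4 thus keeps the constant in front
    of the exponential equal to 1. *)
Lemma phi_inv_large (v z : R) : 1 <= v -> 0 <= z -> 4 * v < phi_inv N z ->
  expR (Num.min (sN * v) (v ^+ 2)) <= z.
Proof.
move=> v1 z0; rewrite /phi_inv -/sN; set s := log2 (1 + z); set m := Num.min _ _.
have s0 : 0 <= s by rewrite divr_ge0 ?ln_ge0 ?lerDl// ltW.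
have m1 : 1 <= m.
  rewrite le_min; apply/andP; split; last by rewrite exprn_ege1.
  by rewrite mulr_ege1.
have m4 : 4 * v < Num.max (sN^-1 * s) (Num.sqrt s) -> 4 * m <= s.
  rewrite lt_max => /orP[|].
    rewrite ltr_pdivlMl// => h.
    have : m <= sN * v by rewrite ge_min lexx.
    by lra.
  move=> h; have : m <= v ^+ 2 by rewrite ge_min lexx orbT.
  have : (4 * v) ^+ 2 < s.
    rewrite -[ltRHS](sqr_sqrtr s0) ltr_sqr ?nnegrE ?sqrtr_ge0//.
    by rewrite mulr_ge0// (le_trans ler01).
  by rewrite exprMn; have := sqr_ge0 v; lra.
move=> /m4 ms.
have : 2 * m <= ln (1 + z).
  have : s * ln 2 = ln (1 + z) by rewrite /s /log2 divfK ?gt_eqF.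
  have m0 : 0 <= 4 * m by lra.
  have h2 : 0 <= 2^-1 :> R by [].
  by move=> <-; have := ler_pM m0 h2 ms ln2_half; lra.
rewrite (_ : 2 * m = m + m); last by ring.
move=> h; have : expR (m + m) <= expR (ln (1 + z)) by rewrite ler_expR.
rewrite lnK ?posrE; last by rewrite ltr_wpDr.
rewrite expRD => {}h.
by have := expR_ge1Dx m; nra.
Qed.

Lemma exp_tail_le (Z : Omega -> R) (m : R) : measurable_fun setT Z ->
  (forall w, 0 <= Z w) -> ('E_P[Z] <= 1)%E ->
  (P [set w | (expR m <= Z w)%R] <= (expR (- m))%:E)%E.
Proof.
move=> mZ Z0 EZ; apply: (le_trans (ge0_markov P mZ Z0 (expR_gt0 m))).
by rewrite expRN -[leRHS]mule1 lee_wpmul2l// lee_fin invr_ge0 expR_ge0.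
Qed.

Lemma concentration : (gamma2 F d < +oo)%E ->
  (exists Z : {RV P >-> R},
    [/\ forall w, 0 <= Z w, ('E_P[Z] <= 1)%E &
        {ae P, forall w,
          (sup_centered_squares P X F w <=
            rate_const1%:E * chaining_term N alpha (gamma2 F d) +
            (rate_const2 * (Num.sqrt N%:R)^-1 * alpha ^+ 2 *
              phi_inv N (Z w))%:E)%E}]) /\
  (forall u : R, 0 <= u ->
    completed_prob_le P
      [set w | (sup_centered_squares P X F w >
                  dev_const1%:E * chaining_term N alpha (gamma2 F d) +
                  (dev_const2 * (Num.sqrt N%:R)^-1 * alpha ^+ 2 * u)%:E)%E]
      (expR (- Num.min (Num.sqrt N%:R * u) (u ^+ 2)))).
Proof.
move=> goo.
have [Z [g [f0 [[mZ Z2 EZ] g0 gle Ff0 aeZ]]]] :=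
  process_bounds N_gt0 indep F_neq0 mG distG tailG sepF dG_le goo.
have [fs Fs aefs] := separable_enum F_neq0 mG distG tailG sepF dG_le.
have gfin : gamma2 F d \is a fin_num.
  by rewrite ge0_fin_numE// (gamma2_ge0 F_neq0 FG distG).
move: gle; rewrite -(fineK gfin) -EFinM lee_fin; set c := fine _ => gc.
rewrite chaining_termE; set Ga := chain_real c; rewrite -/sN.
have c0 : 0 <= c by lra.
have Ga0 : 0 <= Ga := chain_real_ge0 c0.
have rateGa := chain_rate_le g0 gc; rewrite -/Ga in rateGa.
have Z0 w : 0 <= Z w by apply: le_trans (Z2 w).
pose rho := sN^-1 * alpha ^+ 2.
have rho0 : 0 <= rho by rewrite mulr_ge0 ?sqr_ge0// invr_ge0 ltW.
have iN0 : 0 <= N%:R^-1 :> R by rewrite invr_ge0 ltW.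
have s0 w : 0 <= log2 (1 + Z w).
  by rewrite divr_ge0 ?ln_ge0 ?lerDl// ltW.
have bound1 : {ae P, forall w f, F f -> N%:R^-1 * csq X f (cst 0) w <=
    rate_const1 * Ga + rate_const2 * rho * phi_inv N (Z w)}.
  apply: filterS aeZ => w H f Ff; have [h _] := H f Ff.
  apply: (le_trans (ler_wpM2l iN0 h)); rewrite -/sN mulrDr.
  set s := log2 _; apply: lerD.
    rewrite mulrCA.
    have k3 : 0 <= 3 * chain_const :> R by rewrite mulr_ge0.
    apply: (le_trans (ler_wpM2l k3 rateGa)).
    by rewrite /rate_const1; lra.
  have -> : N%:R^-1 * ((4 * chain_const + 5 * bern_const) * alpha ^+ 2 *
      (sN * Num.sqrt s + s)) = (4 * chain_const + 5 * bern_const) * rho *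
      (Num.sqrt s + sN^-1 * s).
    by rewrite sNE /rho; field; rewrite gt_eqF.
  have k9 : 0 <= (4 * chain_const + 5 * bern_const) * rho.
    apply: mulr_ge0 => //; have := K1_ge0; have := K2_ge0; lra.
  have h1 : Num.sqrt s <= phi_inv N (Z w) by rewrite le_max lexx orbT.
  have h2 : sN^-1 * s <= phi_inv N (Z w) by rewrite le_max lexx.
  have -> : rate_const2 * rho * phi_inv N (Z w) =
      (4 * chain_const + 5 * bern_const) * rho * (2 * phi_inv N (Z w)).
    by rewrite /rate_const2; ring.
  by apply: ler_wpM2l => //; lra.
split.
  exists (mfun_Sub (mem_set mZ)); split => //.
  apply: filterS bound1 => w H; rewrite -EFinM -EFinD.
  apply/sup_centered_squares_leP => f Ff.
  by rewrite -(mulrA rate_const2); exact: H.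
move=> u u0; rewrite -EFinM -EFinD -(mulrA dev_const2) -/rho.
set t := dev_const1 * Ga + dev_const2 * rho * u.
set m := Num.min _ _.
pose B := \bigcup_j [set w | t < N%:R^-1 * csq X (fs j) (cst 0) w].
have mB : measurable B.
  apply: bigcup_measurable => j _.
  rewrite (_ : [set w | _] = setT `&`
      (fun w => N%:R^-1 * csq X (fs j) (cst 0) w) @^-1` `]t, +oo[).
    have mh : measurable_fun setT (fun w => N%:R^-1 * csq X (fs j) (cst 0) w).
      by apply: measurable_funM => //; exact: (measurable_csq X mG (FG (Fs j)) G0).
    exact: mh.
  by rewrite setTI; apply/seteqP; split => w /=; rewrite in_itv/= andbT.
set E := [set w | _].
have notE w : ~ E w <-> forall f, F f -> N%:R^-1 * csq X f (cst 0) w <= t.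
  rewrite -sup_centered_squares_leP /E /=; split=> [/negP|h].
    by rewrite -leNgt.
  by apply/negP; rewrite -leNgt.
have EB : {ae P, forall w, E w <-> B w}.
  apply: filterS aefs => w H; split => [Ew|[j _ /= hj]].
    apply: contrapT => nB; move: Ew; apply/notE => f Ff.
    rewrite ler_pdivrMl//; apply: (H f (cst 0) _ Ff G0) => j.
    rewrite -ler_pdivrMl// leNgt; apply/negP => h.
    by apply: nB; exists j.
  apply: contrapT => /notE /(_ _ (Fs j)).
  by rewrite leNgt hj.
have large v : 1 <= v -> rate_const1 * Ga + 4 * rate_const2 * rho * v <= t ->
    expR (- Num.min (sN * v) (v ^+ 2)) <= expR (- m) ->
    completed_prob_le P E (expR (- m)).
  move=> v1 vt vm.
  pose D := [set w | expR (Num.min (sN * v) (v ^+ 2)) <= Z w].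
  apply: (@completed_prob_leI _ _ _ P E B D) => //.
  - exact: measurable_superlevel.
  - apply: filterS bound1 => w H Ew; apply: phi_inv_large => //.
    rewrite ltNge; apply/negP => h; move: Ew; apply/notE => f Ff.
    apply: (le_trans (H f Ff)); apply: le_trans vt; rewrite lerD2l.
    have -> : 4 * rate_const2 * rho * v = rate_const2 * rho * (4 * v) by ring.
    by apply: ler_wpM2l => //; rewrite mulr_ge0.
  - by apply: le_trans (exp_tail_le _ mZ Z0 EZ) _; rewrite lee_fin.
have d2 : 4 * rate_const2 <= dev_const2 :> R := dev_const2_ge.
have d1 : rate_const1 * Ga <= dev_const1 * Ga.
  by apply: ler_wpM2r => //; rewrite /dev_const1;
    have := rate2_ge0; have := rate3_ge0; lra.
have [u1|u1] := leP 1 u.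
  apply: (large u u1) => //; apply: lerD => //.
  by apply: ler_wpM2r => //; apply: ler_wpM2r.
have mu2 : m <= u ^+ 2 by rewrite ge_min lexx orbT.
have [rG|Gr] := leP rho Ga.
  (* [u < 1] makes [m <= u^2 <= 1], and 1 is the exponent reached at [v = 1]. *)
  apply: (large 1 (lexx 1)).
    have : 0 <= dev_const2 * rho * u.
      by rewrite mulr_ge0// mulr_ge0// (le_trans _ d2)// mulr_ge0.
    have h1 : rate_const2 * rho <= rate_const2 * Ga by exact: ler_wpM2l.
    have h2 : 0 <= rate_const3 * Ga by exact: mulr_ge0.
    by rewrite /t /dev_const1; lra.
  rewrite ler_expR lerN2; apply: (@le_trans _ _ 1).
    by rewrite (le_trans mu2)// exprn_ile1// ltW.
  by rewrite mulr1 expr1n le_min sN_ge1/=.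
have rho_gt0 : 0 < rho := le_lt_trans Ga0 Gr.
pose lam := small_const * u.
have lam0 : 0 <= lam by rewrite mulr_ge0// ltW.
(* One inequality for two needs: [32 lam <= 1] for [csq_mgf], and [4 lam rate_const3 <= 1] for
   [p <= 1]. *)
have lam_small : lam * (32 + 4 * rate_const3) <= 1.
  rewrite /lam mulrAC mulVf ?mul1r ?ltW// gt_eqF// ltr_wpDr// mulr_ge0//.
pose q := rate_const3 * Ga / rho.
have q0 : 0 <= q by rewrite divr_ge0// mulr_ge0.
have qle : q <= rate_const3.
  by rewrite ler_pdivrMr//; apply: ler_wpM2l => //; exact: ltW.
(* The factor 2 in [p] and [l] comes from splitting a product of two exponentials into their
   squares; [ln 2] converts [log2] into [ln]. *)
pose p := 2 * lam * q / ln 2.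
have p0 : 0 <= p by rewrite divr_ge0 ?(ltW ln2_gt0)// mulr_ge0// mulr_ge0.
have p4 : p <= 4 * lam * q.
  rewrite ler_pdivrMr//.
  have : 0 <= lam * q by exact: mulr_ge0.
  by have := ln2_half; nra.
have p1 : p <= 1.
  apply: (le_trans p4).
  have : lam * q <= lam * rate_const3 by exact: ler_wpM2l.
  by lra.
pose l := 2 * lam / (rho * N%:R).
have l0 : 0 <= l by apply: divr_ge0; [exact: mulr_ge0|rewrite mulr_ge0// ltW].
(* [b] dominates [e^(2 lam q (s - 2))]: it is [e^(- 4 lam q)] times Bernoulli's bound for
   [(1 + Z)^p]. The shift by 2 gives [E b <= 1], since [p <= 4 lam q] by [ln 2 >= 1/2]. *)
pose b w := expR (- (4 * lam * q)) * (1 + p * Z w).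
pose h w := 2^-1 * (expR (l * csq X f0 (cst 0) w) + b w).
have Gf0 := FG Ff0.
have mcs := measurable_csq X mG Gf0 G0.
have me : measurable_fun setT (fun w => expR (l * csq X f0 (cst 0) w)).
  by apply: measurableT_comp => //; exact: measurable_funM.
have mpZ : measurable_fun setT (fun w => p * Z w) by exact: measurable_funM.
have m1pZ : measurable_fun setT (fun w => 1 + p * Z w) by exact: measurable_funD.
have mb : measurable_fun setT b by exact: measurable_funM.
have mh : measurable_fun setT h.
  by apply: measurable_funM => //; exact: measurable_funD.
have pZ0 w : 0 <= 1 + p * Z w by rewrite addr_ge0// mulr_ge0.
have b0 w : 0 <= b w by rewrite mulr_ge0 ?expR_ge0.
have h0 w : 0 <= h w by rewrite mulr_ge0// addr_ge0 ?expR_ge0.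
have Eb : ('E_P[b] <= 1)%E.
  rewrite ge0_expectationZl ?expR_ge0//.
  rewrite ge0_expectationD//; last by move=> w; rewrite mulr_ge0.
  rewrite ge0_expectationZl// expectation_cst.
  apply: (@le_trans _ _ ((expR (- (4 * lam * q)))%:E * (1 + p)%:E)%E).
    apply: lee_wpmul2l; first by rewrite lee_fin expR_ge0.
    rewrite EFinD leeD2l// -[leRHS]mule1 lee_wpmul2l// lee_fin//.
  rewrite -EFinM lee_fin -[leRHS](expRxMexpNx_1 (4 * lam * q)) mulrC.
  apply: ler_wpM2r; first exact: expR_ge0.
  by apply: le_trans (expR_ge1Dx _); rewrite lerD2l.
have C2_ge0 := @small_mgf_const_ge0 R.
have Ee : ('E_P[fun w => (expR (l * csq X f0 (cst 0) w))%R] <=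
    (expR (small_mgf_const * lam ^+ 2))%:E)%E.
  have lK : l * bern_scale d alpha f0 (cst 0) <= 16 * lam / sN.
    have alpha2 : 0 < alpha ^+ 2.
      by move: rho_gt0; rewrite /rho pmulr_rgt0// invr_gt0.
    apply: (@le_trans _ _ (l * (8 * alpha ^+ 2))).
      apply: ler_wpM2l => //; rewrite /bern_scale expr2 mulrA.
      by apply: ler_wpM2l; [rewrite mulr_ge0|exact: dG_le].
    rewrite /l /rho sNE le_eqVlt; apply/orP; left; apply/eqP.
    have alpha_neq0 : alpha != 0 by rewrite -sqrf_eq0 gt_eqF.
    by field; rewrite ?alpha_neq0 ?gt_eqF.
  have K0 : 0 <= l * bern_scale d alpha f0 (cst 0).
    by rewrite mulr_ge0// (bern_scale_ge0 distG G0 dG_le).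
  have lam32 : 32 * lam <= 1.
    by have : 0 <= lam * rate_const3 by [exact: mulr_ge0]; lra.
  apply: (le_trans (csq_mgf indep mG distG tailG G0 dG_le Gf0 G0 l0 _)).
    apply: (le_trans lK); rewrite ler_pdivrMr//.
    by have := sN_ge1; lra.
  rewrite lee_fin ler_expR.
  have -> : 16 * exp_moment_bound * N%:R * l ^+ 2 *
      bern_scale d alpha f0 (cst 0) ^+ 2 = 16 * exp_moment_bound *
      (N%:R * (l * bern_scale d alpha f0 (cst 0)) ^+ 2) by ring.
  have -> : small_mgf_const * lam ^+ 2 = 16 * exp_moment_bound * (16 * 16 * lam ^+ 2).
    by rewrite /small_mgf_const; ring.
  apply: ler_wpM2l; first by rewrite mulr_ge0.
  have -> : 16 * 16 * lam ^+ 2 = N%:R * (16 * lam / sN) ^+ 2.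
    by rewrite sNE; field; rewrite gt_eqF.
  apply: ler_wpM2l; first exact: ltW.
  by rewrite ler_sqr// nnegrE divr_ge0 ?mulr_ge0// ltW.
have C20 : 0 <= small_mgf_const * lam ^+ 2 by exact: mulr_ge0 (sqr_ge0 _).
have Eh : ('E_P[h] <= (expR (small_mgf_const * lam ^+ 2))%:E)%E.
  rewrite ge0_expectationZl//; last 2 first.
  - exact: measurable_funD.
  - by move=> w; rewrite addr_ge0 ?expR_ge0.
  rewrite ge0_expectationD//.
  rewrite lee_pdivrMl//; apply: (le_trans (leeD Ee Eb)).
  rewrite -EFinD -EFinM lee_fin.
  have : 1 <= expR (small_mgf_const * lam ^+ 2) by rewrite -expR0 ler_expR.
  by lra.
pose D := [set w | expR (lam * (dev_const2 * u)) <= h w].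
apply: (@completed_prob_leI _ _ _ P E B D) => //.
- exact: measurable_superlevel.
- apply: filterS aeZ => w H Ew.
  have [f Ff ft] : exists2 f, F f & t < N%:R^-1 * csq X f (cst 0) w.
    apply: contrapT => nf; move: Ew; apply/notE => f Ff.
    by rewrite leNgt; apply/negP => ht; apply: nf; exists f.
  have [_] := H f Ff; set s := log2 (1 + Z w) => hs.
  have s0w : 0 <= s := s0 w.
  pose Y := N%:R^-1 * csq X f0 (cst 0) w.
  have h1 : N%:R^-1 * csq X f f0 w <= rate_const3 * Ga * (1 + s).
    apply: (le_trans (ler_wpM2l iN0 hs)).
    have -> : N%:R^-1 * (2 * chain_const * (1 + s) * chain_rate N alpha g) =
      2 * chain_const * (1 + s) * (N%:R^-1 * chain_rate N alpha g) by ring.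
    have -> : rate_const3 * Ga * (1 + s) =
      2 * chain_const * (1 + s) * (4 * Ga) by rewrite /rate_const3; ring.
    by apply: ler_wpM2l => //; rewrite mulr_ge0 ?addr_ge0// mulr_ge0.
  have h2 : dev_const2 * u < Y / rho + q * (s - 2).
    have -> : Y / rho + q * (s - 2) = (Y + rate_const3 * Ga * (s - 2)) / rho.
      by rewrite /q; field; rewrite gt_eqF.
    rewrite ltr_pdivlMr//.
    move: ft; rewrite (csq_trans X f0) mulrDr -/Y /t.
    have h3 : 0 <= rate_const1 * Ga by rewrite mulr_ge0// ltW.
    have h4 : 0 <= rate_const2 * Ga by exact: mulr_ge0.
    by rewrite /dev_const1; lra.
  rewrite /D /=.
  apply: (@le_trans _ _ (expR (lam * (Y / rho + q * (s - 2))))).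
    by rewrite ler_expR; apply: ler_wpM2l => //; exact: ltW.
  rewrite mulrDr expRD.
  have x2 : expR (lam * (Y / rho)) ^+ 2 = expR (l * csq X f0 (cst 0) w).
    rewrite -expRM_natl; congr expR; rewrite /l /Y; field.
    by rewrite gt_eqF//= gt_eqF.
  have y2 : expR (lam * (q * (s - 2))) ^+ 2 <= b w.
    rewrite -expRM_natl /b.
    have -> : 2 * (lam * (q * (s - 2))) = - (4 * lam * q) + p * ln (1 + Z w).
      by rewrite /p /s /log2; field; rewrite gt_eqF.
    rewrite expRD; apply: ler_wpM2l; first exact: expR_ge0.
    have := @bernoulli_expR R (ln (1 + Z w)) p; rewrite p0 p1 => /(_ isT).
    by rewrite lnK ?posrE ?ltr_wpDr// (addrC 1 (Z w)) addrK.
  rewrite /h -x2; have := sqr_ge0 (expR (lam * (Y / rho)) -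
    expR (lam * (q * (s - 2)))).
  by rewrite sqrrB; lra.
- apply: (le_trans (ge0_markov P mh h0 (expR_gt0 _))).
  apply: (@le_trans _ _ ((expR (lam * (dev_const2 * u)))^-1%:E *
      (expR (small_mgf_const * lam ^+ 2))%:E)%E).
    by apply: lee_wpmul2l => //; rewrite lee_fin invr_ge0 expR_ge0.
  rewrite -EFinM lee_fin -expRN -expRD ler_expR.
  have h1 := @small_dev_const R.
  have := ler_wpM2r (sqr_ge0 u) h1.
  rewrite /lam exprMn => h2.
  have -> : - (small_const * u * (dev_const2 * u)) +
      small_mgf_const * (small_const ^+ 2 * u ^+ 2) =
      - (small_const * dev_const2 * u ^+ 2) +
      small_mgf_const * small_const ^+ 2 * u ^+ 2 by ring.
  by move: h2 mu2; lra.
Qed.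

End concentration.

Theorem theorem1 (R : realType) :
  exists A B A' B' : R,
  forall (N : nat) (dO dX : measure_display) (Omega : measurableType dO)
    (TX : measurableType dX) (P : probability Omega R)
    (X : 'I_N -> {RV P >-> TX}) (F : set (TX -> R))
    (d : (TX -> R) -> (TX -> R) -> R) (alpha : R),
  (1 <= N)%N ->
  mutually_independent P X ->
  F !=set0 ->
  (forall f, F f -> measurable_fun setT f) ->
  is_distance (F `|` [set cst 0]) d ->
  (forall f g, F f -> F g -> forall (i : 'I_N) (u : R), 0 < u ->
    (P [set w | (u <= `|f (X i w) - g (X i w)|)%R] <=
       (2 * gauss_tail u (d f g))%:E)%E /\
    (P [set w | (u <= `|f (X i w)|)%R] <=
       (2 * gauss_tail u (d f (cst 0)))%:E)%E) ->
  separable_process P X F d ->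
  ereal_sup [set (d f (cst 0))%:E | f in F] = alpha%:E ->
  (exists Z : {RV P >-> R},
    [/\ forall w, 0 <= Z w,
        ('E_P[Z] <= 1)%E &
        {ae P, forall w,
          (sup_centered_squares P X F w <=
            A%:E * chaining_term N alpha (gamma2 F d) +
            (B * (Num.sqrt N%:R)^-1 * alpha ^+ 2 * phi_inv N (Z w))%:E)%E}]) /\
  (forall u : R, 0 <= u ->
    completed_prob_le P
      [set w | (sup_centered_squares P X F w >
                  A'%:E * chaining_term N alpha (gamma2 F d) +
                  (B' * (Num.sqrt N%:R)^-1 * alpha ^+ 2 * u)%:E)%E]
      (expR (- Num.min (Num.sqrt N%:R * u) (u ^+ 2)))).
Proof.
exists rate_const1, rate_const2, dev_const1, dev_const2.
move=> N dO dX Omega TX P X F d alpha N1 indep F0 mF distG tail sepF alphaE.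
have G0 : (F `|` [set cst 0]) (cst 0) by right.
have mG f : (F `|` [set cst 0]) f -> measurable_fun setT f.
  by move=> [|->]; [exact: mF|exact: measurable_cst].
have dF f : F f -> d f (cst 0) <= alpha.
  by move=> Ff; rewrite -lee_fin -alphaE; apply: ereal_sup_ubound; exists f.
have d00 : d (cst 0) (cst 0) = 0 by exact: (distance_eq0 distG G0 G0).2.
have alpha0 : 0 <= alpha.
  have [f Ff] := F0; apply: le_trans (dF f Ff).
  by apply: (distance_ge0 distG) => //; left.
have dG_le f : (F `|` [set cst 0]) f -> d f (cst 0) <= alpha.
  by move=> [/dF//|->]; rewrite d00.
(* With [cst 0] adjoined to the family, the second tail hypothesis becomes the case [g = cst 0] of
   the first. *)
have tailG f g : (F `|` [set cst 0]) f -> (F `|` [set cst 0]) g ->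
    forall (i : 'I_N) (u : R), 0 < u ->
    (P [set w | (u <= `|f (X i w) - g (X i w)|)%R] <=
       (2 * gauss_tail u (d f g))%:E)%E.
  move=> [Ff|->] [Fg|->] i u u0.
  - by have [] := tail f g Ff Fg i u u0.
  - have [_] := tail f f Ff Ff i u u0.
    by under [X in P X]eq_set do rewrite -[f _]subr0.
  - have [_] := tail g g Fg Fg i u u0.
    rewrite (distance_sym distG G0 (or_introl Fg)).
    by under [in X in _ -> X]eq_set do rewrite sub0r normrN.
  - rewrite (_ : [set w | _] = set0) ?measure0 ?lee_fin ?mulr_ge0//.
      by rewrite /gauss_tail; case: ifP => // _; exact: expR_ge0.
    by apply/seteqP; split => w //=; rewrite subrr normr0 leNgt u0.
have [goo|] := ltP (gamma2 F d) +oo%E.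
  exact: concentration.
rewrite leye_eq => /eqP ->.
have sN0 : 0 < (Num.sqrt N%:R)^-1 :> R by rewrite invr_gt0 sqrtr_gt0 ltr0n.
have chainoo : chaining_term N alpha (+oo)%E = (+oo)%E.
  rewrite /chaining_term expe2 mulyy gt0_muley ?lte_fin ?invr_gt0 ?ltr0n//.
  rewrite addye// -ltNye (@lt_le_trans _ _ 0%E)// mule_ge0// lee_fin.
  by rewrite mulr_ge0// ltW.
(* A positive constant times an infinite chaining term is infinite: [Z = 0] serves, and the
   deviation event is empty. *)
have [r1 r2] : 0 < rate_const1 :> R /\ 0 < dev_const1 :> R.
  by split; [exact: rate_const1_gt0|exact: dev_const1_gt0].
rewrite chainoo !gt0_muley ?lte_fin//; split.
  have mZ : measurable_fun setT (cst 0 : Omega -> R) by exact: measurable_cst.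
  exists (mfun_Sub (mem_set mZ)); split => //=.
    by rewrite expectation_cst.
  by apply: aeW => w; rewrite addye// leey.
move=> u u0; apply: (@completed_prob_leI _ _ _ P _ set0 set0) => //.
- by apply: aeW => w; rewrite /= addye// ltNge leey.
- by apply: aeW => w; rewrite /= addye// ltNge leey.
- by rewrite measure0 lee_fin expR_ge0.
Qed.
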